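(* The following are equivalent for a matroid $N$. (i) Each component of $N$ has rank at most one or can be obtained from a circuit by a sequence of parallel extensions. (ii) $N$ is graphic and laminar. (iii) $N$ is regular and laminar. (iv) $N$ is binary and laminar. (v) $N$ has no minor isomorphic to a member of $\{Y_3,U_{2,4}\}$.
   Context: All matroids are finite. A family $\mathcal{A}$ of subsets of a finite set $E$ is laminar if, for all $A,B\in\mathcal{A}$ with $A\cap B\neq\emptyset$, either $A\subseteq B$ or $B\subseteq A$. Given a laminar family $\mathcal{A}$ of subsets of $E$ and a capacity function $c:\mathcal{A}\to\mathbb{Z}_{\ge 0}$, $M(E,\mathcal{A},c)$ is the matroid on $E$ whose independent sets are exactly the sets $I\subseteq E$ with $|I\cap A|\le c(A)$ for all $A\in\mathcal{A}$. A matroid is laminar if it is isomorphic to some $M(E,\mathcal{A},c)$. $Y_3$ is the matroid obtained by truncating, to rank $3$, the parallel connection of two $3$-element circuits; it is isomorphic to a single-element deletion of the cycle matroid $M(K_4)$. A ''circuit'' as a matroid means $U_{n-1,n}$ for some $n\ge 1$. A parallel extension of a matroid $M$ is a matroid obtained by adjoining to $M$ a new element $f$ in parallel with a non-loop element $e$ of $M$ (so that $\{e,f\}$ is a circuit and deleting $f$ gives $M$). *)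

(* Defs.v *)
From HB Require Import structures.
From Stdlib Require Rdefinitions.
From mathcomp Require Import all_boot all_order all_algebra.
From mathcomp Require Import boolp.
From mathcomp Require Import Rstruct.

Set Implicit Arguments.
Unset Strict Implicit.
Unset Printing Implicit Defensive.

Import GRing.Theory.

(* The ground set is a subset of the carrier finType [T], so that minors of a
   matroid on [T] are again matroids on [T]. *)
Record matroid (T : finType) := Matroid {
  ground : {set T};
  indep : {set {set T}};
  indep_sub : forall I : {set T}, I \in indep -> I \subset ground;
  indep0 : set0 \in indep;
  indep_hered : forall I J : {set T}, I \subset J -> J \in indep -> I \in indep;
  indep_aug : forall I J : {set T}, I \in indep -> J \in indep -> #|I| < #|J| ->
    exists2 e, e \in J :\: I & e |: I \in indep }.

Definition same_matroid (T : finType) (M M' : matroid T) : Prop :=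
  ground M = ground M' /\ indep M = indep M'.

(* The bijection is between the ground sets seen as types: a map [T1 -> T2]
   restricted to [ground M1] would not exist when [T2] is empty and [T1] is
   not, even if both ground sets are empty. *)
Definition isomorphic (T1 T2 : finType) (M1 : matroid T1) (M2 : matroid T2) :
    Prop :=
  exists f : {x : T1 | x \in ground M1} -> {y : T2 | y \in ground M2},
    bijective f /\
    forall I : {set {x : T1 | x \in ground M1}},
      ([set val x | x in I] \in indep M1)
      = ([set val (f x) | x in I] \in indep M2).

Section Notions.
Variables (T : finType) (M : matroid T).

Definition circuit (C : {set T}) : bool :=
  minset (fun D => (D \subset ground M) && (D \notin indep M)) C.

Definition basis_of_set (X B : {set T}) : bool :=
  maxset (fun I => (I \in indep M) && (I \subset X)) B.

Definition rank : nat := \max_(I in indep M) #|I|.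

(* Classes of the relation "equal or on a common circuit". *)
Definition component (C : {set T}) : Prop :=
  exists2 e, e \in ground M &
    C = [set f in ground M |
          (f == e) || [exists D, [&& circuit D, e \in D & f \in D]]].

Lemma basis_of_set_card X B1 B2 :
  basis_of_set X B1 -> basis_of_set X B2 -> #|B1| = #|B2|.
Proof.
suff le_card A B : basis_of_set X A -> basis_of_set X B -> #|B| <= #|A|.
  by move=> b1 b2; apply/eqP; rewrite eqn_leq !le_card.
move=> /maxsetP[/andP[iA sA] maxA] /maxsetP[/andP[iB sB] _].
rewrite leqNgt; apply/negP => /(indep_aug iA iB)[e].
rewrite inE => /andP[eA eB] ieA; move: eA; rewrite -(maxA (e |: A)) ?setU11 //.
  by rewrite ieA subUset sub1set (subsetP sB).
exact: subsetUr.
Qed.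

Lemma basis_of_set_exists X : exists B, basis_of_set X B.
Proof.
have [|B] := @maxset_exists _ (fun I => (I \in indep M) && (I \subset X)) set0.
  by rewrite indep0 sub0set.
by exists B.
Qed.

End Notions.

Section Minors.
Variables (T : finType) (M : matroid T).
Implicit Types I J : {set T}.

Section Restriction.
Variable X : {set T}.

Let restr_indep := [set I in indep M | I \subset X].

Let restr_sub I : I \in restr_indep -> I \subset ground M :&: X.
Proof. by rewrite inE subsetI => /andP[/indep_sub-> ->]. Qed.

Let restr0 : set0 \in restr_indep.
Proof. by rewrite inE indep0 sub0set. Qed.

Let restr_hered I J : I \subset J -> J \in restr_indep -> I \in restr_indep.
Proof.
move=> sIJ; rewrite !inE => /andP[iJ sJX].
by rewrite (indep_hered sIJ iJ) (subset_trans sIJ sJX).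
Qed.

Let restr_aug I J : I \in restr_indep -> J \in restr_indep -> #|I| < #|J| ->
  exists2 e, e \in J :\: I & e |: I \in restr_indep.
Proof.
rewrite !inE => /andP[iI sIX] /andP[iJ sJX] /(indep_aug iI iJ)[e eJI ieI].
exists e => //; rewrite inE ieI subUset sub1set sIX andbT (subsetP sJX) //.
by case/setDP: eJI.
Qed.

Definition restriction : matroid T :=
  Matroid restr_sub restr0 restr_hered restr_aug.
End Restriction.

Definition deletion (X : {set T}) : matroid T := restriction (ground M :\: X).

Section Contraction.
Variable X : {set T}.

Let contr_indep := [set I : {set T} | (I \subset ground M :\: X) &&
  [exists B, basis_of_set M X B && (I :|: B \in indep M)]].

Let contr_sub I : I \in contr_indep -> I \subset ground M :\: X.
Proof. by rewrite inE => /andP[]. Qed.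

Let contr0 : set0 \in contr_indep.
Proof.
have [B bB] := basis_of_set_exists M X; rewrite inE sub0set.
apply/existsP; exists B; rewrite bB set0U.
by case/maxsetP: bB => /andP[].
Qed.

Let contr_hered I J : I \subset J -> J \in contr_indep -> I \in contr_indep.
Proof.
move=> sIJ; rewrite !inE => /andP[sJ /existsP[B /andP[bB iJB]]].
rewrite (subset_trans sIJ sJ); apply/existsP; exists B.
by rewrite bB (indep_hered _ iJB) // setSU.
Qed.

Let contr_aug I J : I \in contr_indep -> J \in contr_indep -> #|I| < #|J| ->
  exists2 e, e \in J :\: I & e |: I \in contr_indep.
Proof.
rewrite !inE => /andP[sI /existsP[B1 /andP[b1 i1]]].
move=> /andP[sJ /existsP[B2 /andP[b2 i2]]] ltIJ.
have disj (K B : {set T}) : K \subset ground M :\: X -> basis_of_set M X B ->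
    #|K :|: B| = #|K| + #|B|.
  move=> sK /maxsetP[/andP[_ sB] _]; rewrite cardsU disjoint_setI0 ?cards0 ?subn0 //.
  apply: disjointWl sK _; apply: disjointWr sB _.
  by rewrite -setI_eq0 setIDAC -setIDA setDv setI0.
have [|e] := indep_aug i1 i2.
  by rewrite !disj // (basis_of_set_card b1 b2) ltn_add2r.
rewrite !inE negb_or => /andP[/andP[eI eB1] eJB2] ie.
have eJ : e \in J.
  case/orP: eJB2 => // eB2.
  case/maxsetP: b1 => /andP[_ sB1] max1; case/negP: eB1.
  rewrite -(max1 (e |: B1)) ?setU11 ?subsetUr //.
  rewrite subUset sB1 andbT sub1set; apply/andP; split.
    by apply: indep_hered ie; rewrite setUS ?subsetUr.
  by case/maxsetP: b2 => /andP[_ /subsetP->].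
exists e; first by rewrite inE eI.
rewrite inE subUset sub1set sI (subsetP sJ) //=; apply/existsP; exists B1.
by rewrite b1 -setUA.
Qed.

Definition contraction : matroid T :=
  Matroid contr_sub contr0 contr_hered contr_aug.
End Contraction.

End Minors.

Definition is_minor (T : finType) (M' M : matroid T) : Prop :=
  exists X Y : {set T}, [/\ X \subset ground M, Y \subset ground M,
    [disjoint X & Y] & same_matroid M' (deletion (contraction M X) Y)].

Section Truncation.
Variables (T : finType) (r : nat) (M : matroid T).
Implicit Types I J : {set T}.

Let trunc_indep := [set I in indep M | #|I| <= r].

Let trunc_sub I : I \in trunc_indep -> I \subset ground M.
Proof. by rewrite inE => /andP[/indep_sub]. Qed.

Let trunc0 : set0 \in trunc_indep.
Proof. by rewrite inE indep0 cards0. Qed.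

Let trunc_hered I J : I \subset J -> J \in trunc_indep -> I \in trunc_indep.
Proof.
move=> sIJ; rewrite !inE => /andP[iJ lJ].
by rewrite (indep_hered sIJ iJ) (leq_trans (subset_leq_card sIJ) lJ).
Qed.

Let trunc_aug I J : I \in trunc_indep -> J \in trunc_indep -> #|I| < #|J| ->
  exists2 e, e \in J :\: I & e |: I \in trunc_indep.
Proof.
rewrite !inE => /andP[iI lI] /andP[iJ lJ] lIJ.
have [e eJI ieI] := indep_aug iI iJ lIJ.
exists e => //; rewrite inE ieI cardsU1; case/setDP: eJI => _ ->.
exact: leq_trans lIJ lJ.
Qed.

Definition truncation : matroid T :=
  Matroid trunc_sub trunc0 trunc_hered trunc_aug.
End Truncation.

Section Uniform.
Variables (r n : nat).
Implicit Types I J : {set 'I_n}.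

Let unif_indep := [set I : {set 'I_n} | #|I| <= r].

Let unif_sub I : I \in unif_indep -> I \subset [set: 'I_n].
Proof. by rewrite subsetT. Qed.

Let unif0 : set0 \in unif_indep.
Proof. by rewrite inE cards0. Qed.

Let unif_hered I J : I \subset J -> J \in unif_indep -> I \in unif_indep.
Proof. by move=> /subset_leq_card sIJ; rewrite !inE; apply: leq_trans. Qed.

Let unif_aug I J : I \in unif_indep -> J \in unif_indep -> #|I| < #|J| ->
  exists2 e, e \in J :\: I & e |: I \in unif_indep.
Proof.
rewrite !inE => _ lJ lIJ.
have /set0Pn[e eJI] : J :\: I != set0.
  by apply: contraTneq lIJ => /eqP; rewrite setD_eq0 -leqNgt => /subset_leq_card.
exists e => //; rewrite inE cardsU1; case/setDP: eJI => _ ->.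
exact: leq_trans lIJ lJ.
Qed.

Definition uniform : matroid 'I_n :=
  Matroid unif_sub unif0 unif_hered unif_aug.
End Uniform.

Definition is_circuit_matroid (T : finType) (M : matroid T) : Prop :=
  exists2 n, 0 < n & isomorphic M (uniform n.-1 n).

Definition parallel_extension (T : finType) (M M' : matroid T) : Prop :=
  exists e f, [/\ e \in ground M, f \notin ground M, [set e] \in indep M,
    circuit M' [set e; f] & same_matroid (deletion M' [set f]) M].

Inductive circuit_parallel_extension (T : finType) : matroid T -> Prop :=
| CPE_circuit M : is_circuit_matroid M -> circuit_parallel_extension M
| CPE_extend M M' : circuit_parallel_extension M -> parallel_extension M M' ->
    circuit_parallel_extension M'.

(* [P] is the parallel connection of [M1] and [M2] at [p], specified by its
   circuits; the base point is a loop of neither matroid. *)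
Definition is_parallel_connection (T : finType) (p : T)
    (M1 M2 P : matroid T) : Prop :=
  [/\ ground M1 :&: ground M2 = [set p],
      [set p] \in indep M1,
      [set p] \in indep M2,
      ground P = ground M1 :|: ground M2 &
      forall C : {set T}, circuit P C <->
        [\/ circuit M1 C, circuit M2 C |
            exists C1 C2, [/\ circuit M1 C1, circuit M2 C2,
              p \in C1, p \in C2 & C = (C1 :\ p) :|: (C2 :\ p)]]].

Definition is_Y3 (T : finType) (M : matroid T) : Prop :=
  exists (S : finType) (M1 M2 P : matroid S) (p : S),
    [/\ isomorphic M1 (uniform 2 3), isomorphic M2 (uniform 2 3),
        is_parallel_connection p M1 M2 P & isomorphic M (truncation 3 P)].

Definition laminar_family (T : finType) (E : {set T}) (F : {set {set T}}) :
    Prop :=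
  (forall A, A \in F -> A \subset E) /\
  (forall A B, A \in F -> B \in F -> A :&: B != set0 ->
     A \subset B \/ B \subset A).

Section LaminarMatroid.
Variables (T : finType) (E : {set T}) (F : {set {set T}}) (c : {set T} -> nat).
Hypothesis lamF : laminar_family E F.
Implicit Types I J : {set T}.

Let lam_indep := [set I : {set T} |
  (I \subset E) && [forall (A | A \in F), #|I :&: A| <= c A]].

Let lam_sub I : I \in lam_indep -> I \subset E.
Proof. by rewrite inE => /andP[]. Qed.

Let lam0 : set0 \in lam_indep.
Proof. by rewrite inE sub0set; apply/forall_inP => A _; rewrite set0I cards0. Qed.

Let lam_hered I J : I \subset J -> J \in lam_indep -> I \in lam_indep.
Proof.
move=> sIJ; rewrite !inE => /andP[sJE /forall_inP lJ].
rewrite (subset_trans sIJ sJE); apply/forall_inP => A /lJ.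
by apply/leq_trans/subset_leq_card/setSI.
Qed.

Let lam_aug I J : I \in lam_indep -> J \in lam_indep -> #|I| < #|J| ->
  exists2 e, e \in J :\: I & e |: I \in lam_indep.
Proof.
rewrite !inE => /andP[sIE /forall_inP lI] /andP[sJE /forall_inP lJ] lIJ.
apply/exists_inP; apply: contraLR lIJ; rewrite negb_exists_in => /forall_inP noe.
rewrite -leqNgt.
pose tight := [pred A : {set T} | (A \in F) && (#|I :&: A| == c A)].
have tightP e : e \in J :\: I -> exists2 A, tight A & e \in A.
  move=> eJI; move: (noe e eJI); rewrite inE negb_and.
  case/setDP: (eJI) => eJ eI.
  rewrite subUset sub1set sIE (subsetP sJE) //= negb_forall_in.
  case/exists_inP=> A AF; rewrite -ltnNge => lt; exists A.
    rewrite /= AF eqn_leq lI //= -ltnS (leq_trans lt) //.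
    rewrite setIUl -add1n (leq_trans (leq_card_setU _ _)) ?leq_add2r //.
    by rewrite (leq_trans (subset_leq_card (subsetIl _ _))) ?cards1.
  apply: contraLR lt => eA; rewrite -leqNgt.
  rewrite setIUl (_ : [set e] :&: A = set0) ?set0U ?lI //.
  by apply/setP => x; rewrite !inE; case: eqP => // ->; apply/negbTE.
pose P := [set A | maxset tight A].
have trivP : trivIset P.
  apply/trivIsetP => A B; rewrite !inE => mA mB; apply: contraR => nAB.
  have /andP[AF _] := maxsetp mA; have /andP[BF _] := maxsetp mB.
  rewrite -setI_eq0 in nAB.
  have [sAB|sBA] := lamF.2 _ _ AF BF nAB.
    by rewrite (maxsetsup mA _ sAB) // (maxsetp mB).
  by rewrite (maxsetsup mB _ sBA) // (maxsetp mA).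
have sumP K : #|K :&: cover P| = \sum_(A in P) #|K :&: A|.
  rewrite -sum1_card (eq_bigl (fun x => (x \in cover P) && (x \in K))); last first.
    by move=> x; rewrite inE andbC.
  rewrite (big_trivIset_cond _ trivP) /=; apply: eq_bigr => A _.
  by rewrite -sum1_card; apply: eq_bigl => x; rewrite inE andbC.
rewrite -(cardsID (cover P) I) -(cardsID (cover P) J); apply: leq_add.
  rewrite !sumP; apply: leq_sum => A; rewrite inE => /maxsetp/andP[AF /eqP->].
  exact: lJ.
apply/subset_leq_card/subsetP => x; rewrite !inE => /andP[xP xJ].
rewrite xP; apply: contraR xP => xI.
have [|A tA xA] := tightP x; first by rewrite inE xI.
have [B mB sAB] := maxset_exists tA.
by apply/bigcupP; exists B; rewrite ?inE // (subsetP sAB).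
Qed.

Definition laminar_matroid : matroid T :=
  Matroid lam_sub lam0 lam_hered lam_aug.
End LaminarMatroid.

Definition is_laminar (T : finType) (M : matroid T) : Prop :=
  exists (S : finType) (E : {set S}) (F : {set {set S}}) (c : {set S} -> nat)
    (lamF : laminar_family E F), isomorphic M (laminar_matroid c lamF).

Section VectorMatroid.
Variables (K : fieldType) (m n : nat) (A : 'M[K]_(m, n)).
Implicit Types X Y : {set 'I_n}.

Let cols (X : {set 'I_n}) := [seq col j A | j <- enum X].

Let vec_indep := [set X : {set 'I_n} | free (cols X)].

Let vec_sub X : X \in vec_indep -> X \subset [set: 'I_n].
Proof. by rewrite subsetT. Qed.

Let vec0 : set0 \in vec_indep.
Proof. by rewrite inE /cols enum_set0 nil_free. Qed.

Let vec_hered X Y : X \subset Y -> Y \in vec_indep -> X \in vec_indep.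
Proof.
move=> sXY; rewrite !inE => fY; apply: (@catl_free _ _ (cols (Y :\: X))).
rewrite -(perm_free (X := cols Y)) // /cols -map_cat; apply/perm_map/uniq_perm.
- exact: enum_uniq.
- rewrite cat_uniq !enum_uniq andbT /=; apply/hasPn => j.
  by rewrite !mem_enum inE => /andP[].
move=> j; rewrite mem_cat !mem_enum inE.
by case jX: (j \in X); rewrite // (subsetP sXY).
Qed.

Let vec_aug X Y : X \in vec_indep -> Y \in vec_indep -> #|X| < #|Y| ->
  exists2 e, e \in Y :\: X & e |: X \in vec_indep.
Proof.
rewrite !inE => fX fY; rewrite ltnNge => lXY.
apply/exists_inP; apply: contraR lXY.
rewrite negb_exists_in => /forall_inP noe.
have sz (Z : {set _}) : #|Z| = size (cols Z) by rewrite size_map -cardE.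
rewrite !sz -(eqP fX) -(eqP fY); apply/dimvS/span_subvP => v /mapP[j].
rewrite mem_enum => jY ->; case jX: (j \in X).
  by apply/memv_span/map_f; rewrite mem_enum.
have := noe j; rewrite !inE jX jY => /(_ isT).
rewrite (@perm_free _ _ _ (col j A :: cols X)) ?free_cons ?fX ?andbT ?negbK //.
rewrite /cols -[_ :: _]/(map _ (j :: enum X)); apply/perm_map/uniq_perm.
- exact: enum_uniq.
- by rewrite /= mem_enum jX enum_uniq.
by move=> i; rewrite in_cons !mem_enum !inE.
Qed.

Definition vector_matroid : matroid 'I_n :=
  Matroid vec_sub vec0 vec_hered vec_aug.
End VectorMatroid.

Definition representable (K : fieldType) (T : finType) (M : matroid T) : Prop :=
  exists (m n : nat) (A : 'M[K]_(m, n)), isomorphic M (vector_matroid A).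

Definition is_binary (T : finType) (M : matroid T) : Prop :=
  representable 'F_2 M.

(* The rows and columns of a square submatrix need not be listed in increasing
   order: reordering them only changes the sign of the minor. *)
Definition totally_unimodular (K : comNzRingType) (m n : nat)
    (A : 'M[K]_(m, n)) : Prop :=
  forall (k : nat) (f : 'I_k -> 'I_m) (g : 'I_k -> 'I_n),
    injective f -> injective g ->
    (\det (mxsub f g A))%R \in [:: 0; 1; -1]%R.

Definition is_regular (T : finType) (M : matroid T) : Prop :=
  exists (m n : nat) (A : 'M[Rdefinitions.R]_(m, n)),
    totally_unimodular A /\ isomorphic M (vector_matroid A).

(* Loops and parallel edges are allowed. *)
Record multigraph := Multigraph {
  vertex : finType;
  edge : finType;
  ends : edge -> vertex * vertex }.

Section CycleMatroid.
Variable G : multigraph.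
Implicit Types (e f g h : edge G) (x y z : vertex G) (C I J : {set edge G}).

Definition joins e x y : bool := (ends e == (x, y)) || (ends e == (y, x)).

(* The sequence [:: (x_1, e_1); ..; (x_k, e_k)] stands for the cycle
   x_1 e_1 x_2 .. x_k e_k x_1; a loop is a cycle with k = 1, a pair of
   parallel edges a cycle with k = 2. *)
Definition cycle_step (a b : vertex G * edge G) : bool := joins a.2 a.1 b.1.

Definition graph_cycle C : Prop :=
  exists p : seq (vertex G * edge G),
    [/\ p != [::], uniq (unzip1 p), uniq (unzip2 p), cycle cycle_step p &
        C = [set e in unzip2 p]].

Definition acyclic I : Prop := forall C, graph_cycle C -> ~~ (C \subset I).

Let adj I x y := [exists e in I, joins e x y].
Let conn I := connect (adj I).
Let econn I e := conn I (ends e).1 (ends e).2.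

Let adj_sym I : symmetric (adj I).
Proof. by move=> x y; apply: eq_existsb => e; rewrite /joins orbC. Qed.

Let connC I x y : conn I x y = conn I y x.
Proof. exact: (sym_connect_sym (adj_sym I)). Qed.

Let joins_econn I e x y : joins e x y -> econn I e = conn I x y.
Proof. by rewrite /econn => /orP[]/eqP->; rewrite //= connC. Qed.

Let econn_in I e : e \in I -> econn I e.
Proof.
move=> eI; apply: connect1; apply/exists_inP; exists e => //.
by rewrite /joins -surjective_pairing eqxx.
Qed.

Let conn_trans I J : (forall e, e \in I -> econn J e) ->
  forall e, econn I e -> econn J e.
Proof.
move=> sIJ e; apply: connect_sub => x y /exists_inP[f fI jf].
by rewrite -/(conn J x y) -(joins_econn J jf) sIJ.
Qed.

Let econnS I J e : I \subset J -> econn I e -> econn J e.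
Proof. by move=> /subsetP sIJ; apply: conn_trans => f /sIJ/econn_in. Qed.

Let path_conn I a s b : path cycle_step a (rcons s b) ->
  {subset a.2 :: unzip2 s <= I} -> conn I a.1 b.1.
Proof.
elim: s a => [|a' s IHs] a /= /andP[st pth] sub; last first.
  have step1: conn I a.1 a'.1.
    by rewrite -(joins_econn _ st) econn_in // sub // mem_head.
  apply: connect_trans step1 _.
  by apply: IHs => // f fs; apply: sub; rewrite inE fs orbT.
by rewrite -(joins_econn _ st) econn_in // sub // mem_head.
Qed.

Let cycle_econn C e : graph_cycle C -> e \in C -> econn (C :\ e) e.
Proof.
case=> p [_ _ up cyc ->]; rewrite inE => /mapP[[x e'] xep /= ee'].
move: xep; rewrite -ee' => /rot_to[i s rot_p].
have mem2 f : (f \in unzip2 p) = (f \in e :: unzip2 s).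
  by rewrite -[e :: _]/(unzip2 ((x, e) :: s)) -rot_p /unzip2 map_rot mem_rot.
have : uniq (unzip2 ((x, e) :: s)) by rewrite -rot_p /unzip2 map_rot rot_uniq.
rewrite /= => /andP[es _].
move: cyc; rewrite -(rot_cycle i) rot_p /=.
case: s es mem2 {rot_p} => [|b s] es mem2 /= /andP[st pth].
  by rewrite (joins_econn _ st); apply: connect0.
rewrite (joins_econn _ st) connC; apply: (path_conn pth) => f fs.
by rewrite !inE mem2 inE fs orbT andbT; apply: contraNneq es => <-.
Qed.

Let path_edges I x p : path (adj I) x p -> uniq (x :: p) ->
  exists es : seq (edge G),
    [/\ size es = size p, {subset es <= I}, uniq es,
        {in es, forall f, ((ends f).1 \in x :: p) && ((ends f).2 \in x :: p)} &
        forall g z h, joins g (last x p) z ->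
          sorted cycle_step (rcons (zip (x :: p) (rcons es g)) (z, h))].
Proof.
elim: p x => [|y p IHp] x /=.
  by move=> _ _; exists [::]; split=> //= g z h; rewrite /cycle_step /= andbT.
move=> /andP[/exists_inP[e eI je] pth] /andP[xp up].
have [es [szes sub ues ends_es srt]] := IHp y pth up.
exists (e :: es); split => /=.
- by rewrite szes.
- by move=> f; rewrite inE => /predU1P[->|/sub].
- rewrite ues andbT; apply: contra xp => /ends_es/andP[].
  by case/orP: je => /eqP->.
- move=> f; rewrite inE => /predU1P[->|/ends_es/andP[h1 h2]].
    by case/orP: je => /eqP->; rewrite !inE !eqxx ?orbT.
  by apply/andP; split; rewrite inE ?h1 ?h2 orbT.
move=> g z h jg; have := srt g z h jg.
by case: (es) => [|e' es'] /= ->; rewrite andbT.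
Qed.

Let econn_cycle I e : e \notin I -> econn I e ->
  exists2 C, graph_cycle C & C \subset e |: I.
Proof.
move=> eI /connectP[p0 pth0 lst]; move: lst.
case/shortenP: pth0 => p pth up _ lst {p0}.
have [es [szes sub ues _ srt]] := path_edges pth up.
have je : joins e (last (ends e).1 p) (ends e).1.
  by rewrite -lst /joins -surjective_pairing eqxx orbT.
have sz : size ((ends e).1 :: p) = size (rcons es e) by rewrite size_rcons szes.
pose q := zip ((ends e).1 :: p) (rcons es e).
have q1 : unzip1 q = (ends e).1 :: p by rewrite unzip1_zip ?sz.
have q2 : unzip2 q = rcons es e by rewrite unzip2_zip ?sz.
exists [set f in unzip2 q]; last first.
  apply/subsetP => f; rewrite q2 !inE mem_rcons inE.
  by case/predU1P => [->|/sub->]; rewrite ?eqxx ?orbT.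
exists q; split => //.
- by rewrite -size_eq0 -(size_map fst) -/(unzip1 q) q1.
- by rewrite q1.
- by rewrite q2 rcons_uniq ues andbT; apply: contra eI => /sub.
have := fun h => srt e (ends e).1 h je; rewrite -/q.
by rewrite /q; case: (es) => [|e' es'] srt'; apply: srt'.
Qed.

Let acyclicS I J : I \subset J -> acyclic J -> acyclic I.
Proof.
by move=> sIJ aJ C /aJ; apply: contra => sCI; apply: subset_trans sIJ.
Qed.

Let acyclicU1 I e : acyclic I -> ~~ econn I e -> acyclic (e |: I).
Proof.
move=> aI neI C cC; apply: contra neI => sC.
have [eC|eC] := boolP (e \in C).
  by apply: econnS (cycle_econn cC eC); rewrite subDset.
case/negP: (aI C cC); apply/subsetP => f fC; have := subsetP sC f fC.
by rewrite !inE; case: eqP => // fe; rewrite -fe fC in eC.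
Qed.

Let acyclicU1N I e : e \notin I -> acyclic (e |: I) -> ~~ econn I e.
Proof.
by move=> eI aeI; apply/negP => /(econn_cycle eI)[C /aeI/negP].
Qed.

Let graph_aug I J : acyclic I -> acyclic J -> #|I| < #|J| ->
  exists2 e, e \in J :\: I & ~~ econn I e.
Proof.
have [k] := ubnP #|J :\: I|.
elim: k J I => // k IHk J I leJI aI aJ lIJ.
have /set0Pn[e eJI] : J :\: I != set0.
  by apply: contraTneq lIJ => /eqP; rewrite setD_eq0 -leqNgt => /subset_leq_card.
have [eI|] := boolP (econn I e); last by exists e.
case/setDP: (eJI) => eJ eNI.
have [C cC sC] := econn_cycle eNI eI.
have eC : e \in C.
  apply: contraLR sC => eC; apply: contra (aI C cC) => /subsetP sC.
  apply/subsetP => f fC; have := sC f fC.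
  by rewrite !inE; case: eqP => // fe; rewrite -fe fC in eC.
have /subsetPn[f fC fJ] := aJ C cC.
have fe : f != e by apply: contraNneq fJ => ->.
have fI : f \in I by have := subsetP sC f fC; rewrite !inE (negbTE fe).
pose I' := e |: (I :\ f).
have econn_f : econn I' f.
  apply: econnS (cycle_econn cC fC); rewrite /I'; apply/subsetP => g.
  rewrite !inE => /andP[gf /(subsetP sC)]; rewrite !inE gf.
  by case: eqP.
have nconn_f : ~~ econn (I :\ f) f.
  by apply: acyclicU1N; rewrite ?setD11 ?setD1K.
have aI' : acyclic I'.
  apply: acyclicU1; first by apply: acyclicS aI; apply: subsetDl.
  apply: contra nconn_f => ce; apply: conn_trans econn_f => g.
  by rewrite /I' 2!inE => /predU1P[->//|]; apply: econn_in.
have cardI' : #|I'| = #|I|.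
  by rewrite /I' cardsU1 !inE (negbTE eNI) andbF (cardsD1 f I) fI.
have [||g] := IHk J I' _ aI' aJ; rewrite ?cardI' //.
  rewrite -ltnS (leq_trans _ leJI) // ltnS; apply/proper_card/properP.
  split; last by exists e; rewrite // !inE eqxx.
  apply/subsetP => g; rewrite !inE negb_or negb_and negbK => /andP[/andP[_ h] gJ].
  rewrite gJ andbT; case/orP: h => // /eqP gf.
  by rewrite -gf gJ in fJ.
rewrite !inE negb_or negb_and negbK => /andP[/andP[ge h] gJ] ncg.
exists g.
  rewrite inE gJ andbT; case/orP: h => // /eqP gf.
  by rewrite -gf gJ in fJ.
apply: contra ncg; apply: conn_trans => d dI.
have [->//|df] := eqVneq d f; apply: econn_in.
by rewrite !inE df dI orbT.
Qed.

Let cyc_indep := [set I | `[< acyclic I >]].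

Let cyc_sub I : I \in cyc_indep -> I \subset [set: edge G].
Proof. by rewrite subsetT. Qed.

Let cyc0 : set0 \in cyc_indep.
Proof.
rewrite inE; apply/asboolP => C [[|[x e] p] [//= _ _ _ _ ->]].
by apply/subsetPn; exists e; rewrite !inE ?eqxx.
Qed.

Let cyc_hered I J : I \subset J -> J \in cyc_indep -> I \in cyc_indep.
Proof.
by move=> sIJ; rewrite !inE => /asboolP aJ; apply/asboolP/(acyclicS sIJ).
Qed.

Let cyc_aug I J : I \in cyc_indep -> J \in cyc_indep -> #|I| < #|J| ->
  exists2 e, e \in J :\: I & e |: I \in cyc_indep.
Proof.
rewrite !inE => /asboolP aI /asboolP aJ /(graph_aug aI aJ)[e eJI ce].
by exists e => //; rewrite inE; apply/asboolP/acyclicU1.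
Qed.

Definition cycle_matroid : matroid (edge G) :=
  Matroid cyc_sub cyc0 cyc_hered cyc_aug.
End CycleMatroid.

Definition is_graphic (T : finType) (M : matroid T) : Prop :=
  exists G : multigraph, isomorphic M (cycle_matroid G).

(* Main.v *)
(** A binary laminar matroid cannot have a minor U_{2,4}, since circuits sum to
    dependent sets over F_2, nor a minor Y_3: lifted to the matroid, its two
    3-point lines violate capacities of two sets of the laminar family sharing
    the common point, hence nested, and exchanging points between the lines then
    makes an independent set violate the larger one.

    Conversely, assume that these minors are excluded, and let [D] be a circuit
    with at least three elements.  By contracting elements of [D], every
    non-loop in the span of [D] is parallel to an element of [D]; contracting
    part of an ear of [D] shows that the component of [D] lies in its span.
    Hence every component is a circuit with parallel elements added, or has rank
    at most one.

    Such a matroid is the cycle matroid of the graph of an injective map [s] on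
    the set of all parallel classes (plus one vertex for each component of rank
    one), the edges of a class [v] joining [v] to [s v]; it is laminar for the
    family of its parallel classes and components.  Graphic matroids are regular
    by the signed incidence matrix, whose square submatrices have determinants
    in {0, 1, -1}, and regular matroids are binary by reduction mod 2. *)
Require Import Defs.
From mathcomp Require Import all_boot all_order all_algebra.
From mathcomp Require Import zify.
From mathcomp Require boolp.
From mathcomp Require Import Rstruct.

Set Implicit Arguments.
Unset Strict Implicit.
Unset Printing Implicit Defensive.

Import GRing.Theory.

(** * Rank, circuits and components *)

(** Minors are hardly ever handled as matroids. A set [I] is independent in a minor exactly when
    [B :|: I] is independent in [N], for one fixed basis [B] of the contracted set. Successive
    contractions therefore become a growing set [X], dependence over [X] is counted with the rank
    function of [N], and a matroid is built only when U_{2,4} or Y_3 has been found. Y_3 is used in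
    a concrete form: five points on two 3-point lines through [p], where the dependent sets are the
    lines and the sets of more than three points. Parallel connections occur only in the translation
    to and from this form. The graph and the laminar family are both read off one normal form,
    [cyclic_structure]: the classes of a component form a cycle, and a set is independent when it
    repeats no class and fills no cycle. In a cycle of length one all elements would be loops, so
    the only class of a loopless rank-one component needs an empty second class beside it; this is
    the extra vertex. Independence over the reals and over F_2 is compared through nonzero minors:
    0, 1 and -1 keep the property of being zero or not modulo 2. *)

Ltac nat_lia :=
  intros; repeat match goal with
  | H : @eq nat _ _ |- _ => revert H
  | H : is_true (leq _ _) |- _ => revert H
  end; clear; lia.

Section Rank.
Variables (T : finType) (M : matroid T).
Implicit Types (A B C D I J X Y Z : {set T}) (e f x y z : T).

(** Defined for every subset of the carrier, points off the ground set counting nothing, so that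
    submodularity needs no side condition. *)
Definition rk X : nat := \max_(I in indep M | I \subset X) #|I|.

Lemma card_le_rk I X : I \in indep M -> I \subset X -> #|I| <= rk X.
Proof. by move=> iI sIX; apply: leq_bigmax_cond; rewrite iI. Qed.

Lemma basis_extends I X :
  I \in indep M -> I \subset X -> exists2 B, basis_of_set M X B & I \subset B.
Proof.
move=> iI sIX.
have [|B mB sIB] := @maxset_exists _ (fun J => (J \in indep M) && (J \subset X)) I.
  by rewrite iI.
by exists B.
Qed.

Lemma basis_indep X B : basis_of_set M X B -> B \in indep M.
Proof. by case/maxsetP=> /andP[]. Qed.

Lemma basis_sub X B : basis_of_set M X B -> B \subset X.
Proof. by case/maxsetP=> /andP[]. Qed.

Lemma rk_basis X B : basis_of_set M X B -> rk X = #|B|.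
Proof.
move=> bB; apply/eqP; rewrite eqn_leq card_le_rk ?(basis_indep bB) ?(basis_sub bB) //.
rewrite andbT; apply/bigmax_leqP => I /andP[iI sIX].
have [B' bB' /subset_leq_card] := basis_extends iI sIX.
by rewrite (basis_of_set_card bB bB').
Qed.

Lemma rk_le_card X : rk X <= #|X|.
Proof. by apply/bigmax_leqP => I /andP[_ /subset_leq_card]. Qed.

Lemma rkS X Y : X \subset Y -> rk X <= rk Y.
Proof.
move=> sXY; apply/bigmax_leqP => I /andP[iI sIX].
exact: card_le_rk iI (subset_trans sIX sXY).
Qed.

Lemma indep_rk I : (I \in indep M) = (#|I| <= rk I).
Proof.
apply/idP/idP => [iI|]; first exact: card_le_rk.
have [B bB] := basis_of_set_exists M I; rewrite (rk_basis bB) => le.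
suff -> : I = B by apply: basis_indep bB.
by apply/esym/eqP; rewrite eqEcard (basis_sub bB).
Qed.

Lemma rk_indep I : I \in indep M -> rk I = #|I|.
Proof. by rewrite indep_rk => le; apply/eqP; rewrite eqn_leq rk_le_card. Qed.

Lemma dep_rk X : X \notin indep M -> rk X < #|X|.
Proof. by rewrite indep_rk -ltnNge. Qed.

(** A basis of the intersection extends to a basis [B'] of the union. The traces of [B'] on [X] and
    [Y] are independent, cover [B'], and meet in a set containing the smaller basis. *)
Lemma rk_submod X Y : rk (X :|: Y) + rk (X :&: Y) <= rk X + rk Y.
Proof.
have [B bB] := basis_of_set_exists M (X :&: Y).
have [||B' bB' sBB'] := @basis_extends B (X :|: Y); first exact: basis_indep bB.
  by rewrite (subset_trans (basis_sub bB)) // subIset // subsetUl.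
have rX : #|B' :&: X| <= rk X.
  apply: card_le_rk (subsetIr _ _).
  exact: indep_hered (subsetIl _ _) (basis_indep bB').
have rY : #|B' :&: Y| <= rk Y.
  apply: card_le_rk (subsetIr _ _).
  exact: indep_hered (subsetIl _ _) (basis_indep bB').
rewrite (rk_basis bB) (rk_basis bB'); apply: leq_trans (leq_add rX rY).
rewrite -(cardsUI (B' :&: X)) -setIUr -setIIr (setIidPl (basis_sub bB')) leq_add2l.
by apply: subset_leq_card; rewrite subsetI sBB' (basis_sub bB).
Qed.

Lemma rk_submodS X Y Z :
  Z \subset X -> Z \subset Y -> rk (X :|: Y) + rk Z <= rk X + rk Y.
Proof.
move=> sX sY; apply: leq_trans (rk_submod X Y); rewrite leq_add2l.
by apply: rkS; rewrite subsetI sX.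
Qed.

Lemma rk0 : rk set0 = 0.
Proof. by rewrite rk_indep ?cards0 ?indep0. Qed.

Lemma rk_span_mono X Y Z : X \subset Y -> rk (X :|: Z) = rk X -> rk (Y :|: Z) = rk Y.
Proof.
move=> sXY e; have := @rk_submodS (X :|: Z) Y X (subsetUl _ _) sXY.
rewrite setUAC (setUidPr sXY) e => h.
by have := rkS (subsetUl Y Z); lia.
Qed.

Definition spans X x := rk (x |: X) <= rk X.

Lemma spansS X Y x : X \subset Y -> spans X x -> spans Y x.
Proof.
rewrite /spans => sXY h; rewrite setUC (rk_span_mono sXY) //.
by apply/eqP; rewrite eqn_leq setUC h rkS ?subsetUr.
Qed.

Lemma rk_spans X Y : (forall y, y \in Y -> spans X y) -> rk (X :|: Y) = rk X.
Proof.
have [k] := ubnP #|Y|; elim: k Y => // k IH Y leY sp.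
have [->|[y yY]] := set_0Vmem Y; first by rewrite setU0.
have rI : rk (X :|: Y :\ y) = rk X.
  apply: IH => [|z]; first by rewrite (cardsD1 y) yY in leY.
  by case/setD1P=> _ /sp.
have := spansS (subsetUl X (Y :\ y)) (sp y yY).
rewrite /spans setUCA setD1K // rI => le.
by apply/eqP; rewrite eqn_leq le rkS ?subsetUl.
Qed.

Lemma circuitP C :
  reflect [/\ C \subset ground M, C \notin indep M &
              forall x, x \in C -> C :\ x \in indep M] (circuit M C).
Proof.
apply: (iffP minsetP) => [[/andP[sC dC] mC]|[sC dC iC]].
  split=> // x xC; apply: contraLR xC => dCx.
  have /setP/(_ x) : C :\ x = C.
    by apply: mC (subsetDl _ _); rewrite dCx (subset_trans (subsetDl _ _)).
  by rewrite !inE eqxx => <-.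
split=> [|D /andP[sD dD] sDC]; first by rewrite sC.
apply/eqP; rewrite eqEsubset sDC; apply/subsetP => x xC; apply: contraR dD => xD.
by apply: indep_hered (iC x xC); rewrite subsetD1 sDC.
Qed.

Lemma circuit_sub C : circuit M C -> C \subset ground M.
Proof. by case/circuitP. Qed.

Lemma circuit_dep C : circuit M C -> C \notin indep M.
Proof. by case/circuitP. Qed.

Lemma circuit_psub C I : circuit M C -> I \proper C -> I \in indep M.
Proof.
case/circuitP=> _ _ iC /properP[sI [x xC xI]].
by apply: indep_hered (iC x xC); rewrite subsetD1 sI.
Qed.

Lemma circuit_min C D : circuit M C -> circuit M D -> D \subset C -> D = C.
Proof.
move=> cC cD sDC; apply/eqP; apply: contraNT (circuit_dep cD) => ne.
by apply: circuit_psub cC _; rewrite properEneq ne.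
Qed.

Lemma rk_circuit C : circuit M C -> (rk C).+1 = #|C|.
Proof.
move=> cC; have [_ dC iC] := circuitP _ cC.
have [C0|[x xC]] := set_0Vmem C; first by rewrite C0 indep0 in dC.
have := dep_rk dC; have := rkS (subsetDl C [set x]); rewrite (rk_indep (iC x xC)).
by rewrite (cardsD1 x C) xC; lia.
Qed.

Lemma dep_circuit X : X \subset ground M -> X \notin indep M ->
  exists2 C, circuit M C & C \subset X.
Proof.
move=> sX dX.
have [|C mC sC] := @minset_exists _ (fun D => (D \subset ground M) && (D \notin indep M)) X.
  by rewrite sX.
by exists C.
Qed.

Lemma circuit_spans C x : circuit M C -> x \in C -> spans (C :\ x) x.
Proof.
move=> cC xC; rewrite /spans setD1K //.
have [_ _ iC] := circuitP _ cC; rewrite (rk_indep (iC x xC)).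
by have := rk_circuit cC; rewrite (cardsD1 x C) xC; lia.
Qed.

(** Adding [x] to a basis of [X] creates a circuit, which must use [x] because the basis is
    independent. *)
Lemma spans_circuit X x : x \in ground M -> x \notin X -> X \subset ground M ->
  spans X x -> exists2 C, circuit M C & (x \in C) && (C \subset x |: X).
Proof.
move=> xM xX sX sp; have [B bB] := basis_of_set_exists M X.
have dxB : x |: B \notin indep M.
  rewrite indep_rk -ltnNge cardsU1 (contra (subsetP (basis_sub bB) x) xX).
  rewrite add1n ltnS (leq_trans (rkS (setUS _ (basis_sub bB)))) //.
  by rewrite -(rk_basis bB).
have [|C cC sC] := dep_circuit _ dxB.
  by rewrite subUset sub1set xM (subset_trans (basis_sub bB)).
exists C => //; rewrite (subset_trans sC) ?setUS ?(basis_sub bB) // andbT.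
apply: contraLR (circuit_dep cC) => xC; rewrite negbK.
apply: indep_hered (basis_indep bB); apply/subsetP => y yC.
by have := subsetP sC y yC; rewrite !inE => /predU1P[yx|//]; rewrite -yx yC in xC.
Qed.

(** What is left of the union without [g] and [x] spans [g] through [C2], hence also [x] through
    [C1]; a circuit through [x] follows. *)
Lemma strong_elimination C1 C2 g x : circuit M C1 -> circuit M C2 ->
  g \in C1 :&: C2 -> x \in C1 :\: C2 ->
  exists2 C, circuit M C & (x \in C) && (C \subset (C1 :|: C2) :\ g).
Proof.
move=> c1 c2 /setIP[g1 g2] /setDP[x1 x2].
have gx : g != x by apply: contraNneq x2 => <-.
pose Y := (C1 :|: C2) :\ g :\ x.
have spg : spans Y g.
  apply: spansS (circuit_spans c2 g2); apply/subsetP => y; rewrite !inE.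
  case/andP=> -> y2; rewrite y2 orbT !andbT.
  by apply: contraNneq x2 => <-.
have spx : spans Y x.
  have := spansS _ (circuit_spans c1 x1); rewrite /spans => /(_ (g |: Y)) h.
  apply: leq_trans (leq_trans (h _) spg); first by rewrite rkS // setUS // subsetUr.
  by apply/subsetP => y; rewrite !inE; case: (y == g) => //= /andP[-> ->].
have sM : C1 :|: C2 \subset ground M by rewrite subUset !circuit_sub.
have [|||C cC /andP[xC sC]] := spans_circuit _ _ _ spx.
- by apply: (subsetP sM); rewrite inE x1.
- by rewrite setD11.
- by rewrite 2?(subset_trans (subsetDl _ _)).
exists C => //; rewrite xC (subset_trans sC) // subUset subsetDl andbT.
by rewrite sub1set !inE eq_sym gx x1.
Qed.

(* The pair of intersecting circuits through [x] and [y] with the smallest union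
   shares an element [g]; eliminating [g] in both directions gives a smaller pair. *)
Lemma common_circuit_trans C1 C2 x y : circuit M C1 -> circuit M C2 ->
  x \in C1 -> y \in C2 -> C1 :&: C2 != set0 ->
  exists2 C, circuit M C & (x \in C) && (y \in C).
Proof.
have [k] := ubnP #|C1 :|: C2|; elim: k C1 C2 => // k IH C1 C2 lek c1 c2 x1 y2 /set0Pn[g g12].
have [x2|x2] := boolP (x \in C2); first by exists C2; rewrite ?x2.
have [y1|y1] := boolP (y \in C1); first by exists C1; rewrite ?x1.
have [|C3 c3 /andP[x3 s3]] := strong_elimination c1 c2 g12 (x := x); first by rewrite inE x2.
have [||C4 c4 /andP[y4 s4]] := strong_elimination c2 c1 (g := g) (x := y).
- by rewrite setIC.
- by rewrite inE y1.
have g1 : g \in C1 by case/setIP: g12.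
have g2 : g \in C2 by case/setIP: g12.
have meet3 : C3 :&: C2 != set0.
  apply/negP => /eqP m0; have /circuit_min : C3 \subset C1.
    apply/subsetP => z z3; have := subsetP s3 z z3; rewrite !inE => /andP[_ /orP[//|z2]].
    by have /setP/(_ z) := m0; rewrite !inE z3 z2.
  by move=> /(_ c1 c3) e3; have := subsetP s3 g; rewrite e3 g1 setD11 => /(_ isT).
have [lt3|ge3] := ltnP #|C3 :|: C2| #|C1 :|: C2|.
  by apply: (IH C3 C2) => //; apply: leq_trans lt3 _.
(* If the union does not shrink, [C3] contains all of [C1 :\: C2]. Then [C4], which cannot stay
   inside [C2], meets [C3], and both avoid [g]. *)
have eq3 : C3 :|: C2 = C1 :|: C2.
  apply/eqP; rewrite eqEcard ge3 subUset subsetUr !andbT.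
  exact: subset_trans s3 (subsetDl _ _).
have meet4 : C4 :&: (C1 :\: C2) != set0.
  apply/negP => /eqP m0; have /circuit_min : C4 \subset C2.
    apply/subsetP => z z4; have := subsetP s4 z z4; rewrite !inE => /andP[_ /orP[//|z1]].
    by have /setP/(_ z) := m0; rewrite !inE z4 z1; case: (z \in C2).
  by move=> /(_ c2 c4) e4; have := subsetP s4 g; rewrite e4 g2 setD11 => /(_ isT).
apply: (IH C3 C4) => //.
  apply: leq_trans (_ : #|C1 :|: C2| <= _) => //; apply/proper_card/properP; split.
    by rewrite subUset (subset_trans s3) ?subsetDl // setUC (subset_trans s4) ?subsetDl.
  by exists g; [rewrite inE g1|apply/setUP => -[/(subsetP s3)|/(subsetP s4)]; rewrite setD11].
case/set0Pn: meet4 => z /setIP[z4 /setDP[z1 z2]]; apply/set0Pn; exists z.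
have : z \in C3 :|: C2 by rewrite eq3 inE z1.
by rewrite !inE (negbTE z2) orbF z4 andbT.
Qed.

Definition component_of e : {set T} :=
  [set f in ground M | (f == e) || [exists D, [&& circuit M D, e \in D & f \in D]]].

Lemma component_ofP e : e \in ground M -> component M (component_of e).
Proof. by exists e. Qed.

Lemma mem_component e : e \in ground M -> e \in component_of e.
Proof. by rewrite !inE eqxx => ->. Qed.

Lemma component_ofE e f : f \in component_of e -> component_of e = component_of f.
Proof.
suff sub x y : y \in component_of x -> x \in ground M -> component_of x \subset component_of y.
  move=> fe; have fM : f \in ground M by move: fe; rewrite inE => /andP[].
  move: (fe); rewrite inE => /andP[_ /predU1P[->//|/existsP[D /and3P[cD eD fD]]]].
  have eM := subsetP (circuit_sub cD) e eD.
  apply/eqP; rewrite eqEsubset sub // sub // inE eM.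
  by rewrite orbC; apply/orP; left; apply/existsP; exists D; rewrite cD fD.
rewrite inE => /andP[yM /predU1P[->//|/existsP[D /and3P[cD xD yD]]]] xM.
apply/subsetP => z; rewrite !inE => /andP[zM zx]; rewrite zM /=.
case/predU1P: zx => [->|/existsP[D' /and3P[cD' xD' zD']]]; apply/orP; right; apply/existsP.
  by exists D; rewrite cD yD.
have [|C cC /andP[yC zC]] := common_circuit_trans cD cD' yD zD'.
  by apply/set0Pn; exists x; rewrite inE xD.
by exists C; rewrite cC yC.
Qed.

Lemma circuit_component C e : circuit M C -> e \in C -> C \subset component_of e.
Proof.
move=> cC eC; apply/subsetP => f fC; rewrite inE (subsetP (circuit_sub cC)) //=.
by apply/orP; right; apply/existsP; exists C; rewrite cC eC.
Qed.

End Rank.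

(** * Isomorphism *)

Lemma isomorphic_sym (T1 T2 : finType) (M1 : matroid T1) (M2 : matroid T2) :
  isomorphic M1 M2 -> isomorphic M2 M1.
Proof.
case=> f [[g fK gK] fI]; exists g; split; first by exists f.
move=> I; have := fI [set g y | y in I].
have -> : [set val x | x in [set g y | y in I]] = [set val (g y) | y in I].
  by rewrite -imset_comp.
have -> : [set val (f x) | x in [set g y | y in I]] = [set val y | y in I].
  by rewrite -imset_comp; apply: eq_imset => y /=; rewrite gK.
by move=> ->.
Qed.

Lemma isomorphic_trans (T1 T2 T3 : finType) (M1 : matroid T1) (M2 : matroid T2)
    (M3 : matroid T3) :
  isomorphic M1 M2 -> isomorphic M2 M3 -> isomorphic M1 M3.
Proof.
case=> f [bf fI] [g [bg gI]]; exists (g \o f); split; first exact: bij_comp.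
move=> I; rewrite fI.
have -> : [set val (f x) | x in I] = [set val y | y in f @: I] by rewrite -imset_comp.
by rewrite gI -imset_comp.
Qed.

Lemma isomorphic_intro (T1 T2 : finType) (M1 : matroid T1) (M2 : matroid T2)
    (h : T1 -> T2) :
  {in ground M1 &, injective h} -> h @: ground M1 = ground M2 ->
  (forall I : {set T1}, I \subset ground M1 -> (I \in indep M1) = (h @: I \in indep M2)) ->
  isomorphic M1 M2.
Proof.
move=> hinj him hI.
have hin (x : {x | x \in ground M1}) : h (val x) \in ground M2.
  by rewrite -him imset_f ?(valP x).
pose f x : {y | y \in ground M2} := exist _ (h (val x)) (hin x).
exists f; split.
  have finj : injective f.
    by move=> x y /(congr1 val) /= /hinj exy; apply/val_inj/exy; apply: valP.
  apply: inj_card_bij finj _; rewrite !card_sig.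
  by rewrite -[X in X <= _]/#|ground M2| -him card_in_imset.
move=> I; rewrite hI; last by apply/subsetP => _ /imsetP[x _ ->]; apply: valP.
by rewrite -imset_comp.
Qed.

(** The point [x0] makes a map between the whole carriers possible: its image is the default value
    off the ground set, where an empty [T2] would offer none. *)
Lemma isomorphic_elim (T1 T2 : finType) (M1 : matroid T1) (M2 : matroid T2) (x0 : T1) :
  x0 \in ground M1 -> isomorphic M1 M2 ->
  exists h : T1 -> T2, [/\ {in ground M1 &, injective h}, h @: ground M1 = ground M2 &
    forall I : {set T1}, I \subset ground M1 -> (I \in indep M1) = (h @: I \in indep M2)].
Proof.
move=> x0M [f [bf fI]]; have [g fK gK] := bf.
pose u0 : {x | x \in ground M1} := exist _ x0 x0M.
pose h x := val (f (insubd u0 x)).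
have hE (u : {x | x \in ground M1}) : h (val u) = val (f u) by rewrite /h valKd.
have ins x : x \in ground M1 -> exists u : {x | x \in ground M1}, x = val u.
  by move=> xM; exists (exist _ x xM).
exists h; split.
- move=> _ _ /ins[u ->] /ins[v ->]; rewrite !hE => /val_inj/(can_inj fK) -> //.
- apply/setP => y; apply/imsetP/idP => [[_ /ins[u ->] ->]|yM]; first by rewrite hE; apply: valP.
  exists (val (g (exist _ y yM))); first exact: valP.
  by rewrite hE gK.
- move=> I sI; have -> : I = [set val x | x in [set x : {x | x \in ground M1} | val x \in I]].
    apply/setP => x; apply/idP/imsetP => [xI|[u]]; last by rewrite inE => uI ->.
    have [u ux] := ins x (subsetP sI x xI).
    by exists u; rewrite // inE -ux.
  rewrite fI -imset_comp; apply: (congr1 (fun Z => Z \in indep M2)).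
  by apply: eq_imset => u; rewrite /= hE.
Qed.

Lemma same_isomorphic (T : finType) (M M' : matroid T) :
  same_matroid M M' -> isomorphic M M'.
Proof.
case=> eg ei; apply: (@isomorphic_intro _ _ _ _ id) => //; first by rewrite imset_id.
by move=> I _; rewrite imset_id ei.
Qed.

Lemma isomorphic_uniform (T : finType) (M : matroid T) r n :
  #|ground M| = n ->
  (forall I : {set T}, I \subset ground M -> (I \in indep M) = (#|I| <= r)) ->
  isomorphic M (uniform r n).
Proof.
(* For [n = 0] a nonempty [T] has no map to ['I_0], so the bijection is given directly between the
   empty ground sets. *)
move=> cM iM; case: n cM => [/eqP|n] cM.
  rewrite cards_eq0 in cM; move/eqP in cM.
  have no1 (x : {x | x \in ground M}) : False by case: x => x; rewrite cM inE.
  have no2 (y : {y : 'I_0 | y \in ground (uniform r 0)}) : False by case: y => -[].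
  exists (fun x => False_rect _ (no1 x)); split.
    by exists (fun y => False_rect _ (no2 y)) => [x|y]; [case: (no1 x)|case: (no2 y)].
  move=> I; have -> : I = set0 by apply/setP => x; case: (no1 x).
  by rewrite !imset0 !indep0.
have hinj : {in ground M &, injective (fun x => inord (index x (enum (ground M))) : 'I_n.+1)}.
  have lt z : z \in ground M -> index z (enum (ground M)) < n.+1.
    by move=> zM; rewrite -cM cardE index_mem mem_enum.
  move=> x y xM yM /= /(congr1 val) /=; rewrite !inordK ?lt //.
  by apply: (index_inj x); rewrite mem_enum.
apply: (isomorphic_intro hinj).
  apply/eqP; rewrite eqEcard subsetT (card_in_imset hinj).
  by rewrite cM cardsT card_ord /=.
move=> I sI; rewrite iM // inE card_in_imset // => x y xI yI.
by apply: hinj; apply: (subsetP sI).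
Qed.

(** * Minors and the excluded matroids *)

Section Minor.
Variables (T : finType) (N : matroid T).
Implicit Types (B D I J X Y Q L : {set T}).

(** Contraction asks for some basis of [X] that stays independent with [I]. Any basis will do, since
    together with [I] each has the rank of [X :|: I]; so one [B] serves all [I]. *)
Lemma minor_lift (N' : matroid T) : is_minor N' N ->
  exists B, [/\ ground N' \subset ground N, [disjoint B & ground N'] &
    forall I, I \subset ground N' -> (I \in indep N') = (B :|: I \in indep N)].
Proof.
case=> X [Y [sX sY _ [eg ei]]].
have [B bB] := basis_of_set_exists N X.
exists B; rewrite eg ei /=; split.
- by apply/subsetP => x; rewrite !inE => /andP[/andP[]].
- rewrite disjoint_sym disjoints_subset; apply/subsetP => x; rewrite !inE.
  by case/andP=> /andP[xX _] _; apply: contra xX; apply: (subsetP (basis_sub bB)).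
move=> I sI; have sI' := subset_trans sI (subsetIr _ _); move: sI => /subset_trans/(_ (subsetIl _ _)) sI.
rewrite !inE sI sI' andbT /=; rewrite setUC; apply/existsP/idP => [[B' /andP[bB' iB']]|iB]; last first.
  by exists B; rewrite bB.
have dIX (Z : {set T}) : Z \subset X -> #|I :|: Z| = #|I| + #|Z|.
  move=> sZ; rewrite cardsU disjoint_setI0 ?cards0 ?subn0 //.
  apply: disjointWl sI _; apply: disjointWr sZ _.
  by rewrite -setI_eq0 setIDAC -setIDA setDv setI0.
rewrite indep_rk dIX ?(basis_sub bB) //.
have rB (Z : {set T}) : basis_of_set N X Z -> rk N (Z :|: I) = rk N (X :|: I).
  move=> bZ; have := rk_span_mono (M := N) (subsetUl Z I) (Z := X).
  rewrite (setUidPr (basis_sub bZ)) (rk_basis bZ) (rk_indep (basis_indep bZ)) => /(_ erefl) <-.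
  by rewrite setUAC (setUidPr (basis_sub bZ)).
rewrite [I :|: B]setUC rB // -(rB _ bB') [B' :|: I]setUC (rk_indep iB') dIX ?(basis_sub bB') //.
by rewrite (basis_of_set_card bB bB').
Qed.

(** An independent [X] is its own only basis, so contracting it and deleting all but [Q] gives
    independence over [X] literally. *)
Lemma minor_exists X Q : X \in indep N -> Q \subset ground N -> [disjoint X & Q] ->
  exists2 N', is_minor N' N & ground N' = Q /\
    forall I, (I \in indep N') = (I \subset Q) && (X :|: I \in indep N).
Proof.
move=> iX sQ dXQ; have sX := indep_sub iX.
have sQX : Q \subset ground N :\: X by rewrite subsetD sQ disjoint_sym.
have gE : (ground N :\: X) :\: (ground N :\: X :\: Q) = Q.
  by rewrite setDDr setDv set0U; apply/setIidPr.
exists (deletion (contraction N X) (ground N :\: X :\: Q)).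
  exists X, (ground N :\: X :\: Q); split=> //.
    by rewrite !(subset_trans (subsetDl _ _)).
  rewrite disjoints_subset; apply/subsetP => x xX.
  by rewrite !inE xX andbF.
have bX B : basis_of_set N X B = (B == X).
  apply/idP/eqP => [/maxsetP[/andP[iB sB] mB]|->]; first by rewrite -(mB X) ?iX ?subxx.
  apply/maxsetP; rewrite iX subxx; split=> // B' /andP[_ sB'] sX'.
  by apply/eqP; rewrite eqEsubset sB'.
rewrite /=; split=> [|I]; first by rewrite gE; apply/setIidPr.
rewrite !inE gE; have [sI|_] := boolP (I \subset Q); last by rewrite andbF.
rewrite (subset_trans sI sQX) andbT /=; apply/existsP/idP => [[B]|iI].
  by rewrite bX => /andP[/eqP->]; rewrite setUC.
by exists X; rewrite bX eqxx setUC.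
Qed.

Definition has_forbidden_minor :=
  exists N' : matroid T, is_minor N' N /\ (is_Y3 N' \/ isomorphic N' (uniform 2 4)).

Lemma U24_minor X Q : Q \subset ground N -> [disjoint X & Q] -> #|Q| = 4 ->
  (forall I, I \subset Q -> (X :|: I \in indep N) = (#|I| <= 2)) ->
  has_forbidden_minor.
Proof.
move=> sQ dXQ cQ iXQ.
have iX : X \in indep N by rewrite -[X]setU0 iXQ ?sub0set ?cards0.
have [N' mN' [gN' iN']] := minor_exists iX sQ dXQ.
exists N'; split=> //; right; apply: isomorphic_uniform; rewrite gN' // => I sI.
by rewrite iN' sI iXQ.
Qed.

(* [P := N'] is itself the parallel connection of its restrictions to [L1] and
   [L2], and truncating it to rank 3 changes nothing. *)
Lemma is_Y3_lines (N' : matroid T) p L1 L2 : #|L1| = 3 -> #|L2| = 3 ->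
  L1 :&: L2 = [set p] -> ground N' = L1 :|: L2 ->
  (forall I, I \subset L1 :|: L2 ->
    (I \in indep N') = [&& #|I| <= 3, I != L1 & I != L2]) ->
  is_Y3 N'.
Proof.
move=> c1 c2 c12 gN iN.
have pL : p \in L1 /\ p \in L2 by have /setP/(_ p) := c12; rewrite !inE eqxx => /andP.
case: pL => p1 p2.
have inter x : x \in L1 -> x \in L2 -> x = p.
  by move=> x1 x2; apply/set1P; rewrite -c12 inE x1.
have cQ : #|L1 :|: L2| = 5 by have := cardsUI L1 L2; rewrite c12 cards1 c1 c2; nat_lia.
have small I L : #|L| = 3 -> #|I| < 3 -> I != L by move=> cL; apply: contraTneq => ->; rewrite cL.
have indS I : I \subset L1 :|: L2 -> #|I| < 3 -> I \in indep N'.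
  by move=> sI cI; rewrite iN // !small // (leq_trans (ltnW cI)).
have d1 : L1 \notin indep N' by rewrite iN ?subsetUl // eqxx /= andbF.
have d2 : L2 \notin indep N' by rewrite iN ?subsetUr // eqxx /= !andbF.
have gL L : L \subset L1 :|: L2 -> ground (restriction N' L) = L.
  by move=> sL; rewrite /= gN; apply/setIidPr.
have restrE L (C : {set T}) : L \subset L1 :|: L2 -> #|L| = 3 -> L \notin indep N' ->
    circuit (restriction N' L) C <-> C = L.
  move=> sL cL dL; have iL I : I \in indep (restriction N' L) = (I \subset L) && (#|I| < 3).
    rewrite inE andbC; have [sI|//] := boolP (I \subset L); rewrite /=.
    have [lt|ge] := ltnP; first by rewrite indS // (subset_trans sI).
    apply/negbTE; suff -> : I = L by [].
    by apply/eqP; rewrite eqEcard sI cL.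
  split=> [/circuitP[]|->].
    rewrite gL // iL => sC; rewrite sC /= -leqNgt => ge _.
    by apply/eqP; rewrite eqEcard sC cL.
  apply/circuitP; rewrite gL // iL cL ltnn andbF; split=> // x xL.
  by rewrite iL subsetDl; have := cardsD1 x L; rewrite xL cL; nat_lia.
have uni L : L \subset L1 :|: L2 -> #|L| = 3 -> L \notin indep N' ->
    isomorphic (restriction N' L) (uniform 2 3).
  move=> sL cL dL; apply: isomorphic_uniform; rewrite gL // => I sI.
  rewrite inE sI andbT; have [le|gt] := leqP; first by rewrite indS // (subset_trans sI).
  apply/negbTE; suff -> : I = L by [].
  by apply/eqP; rewrite eqEcard sI cL.
have kL L : L \subset L1 :|: L2 -> #|L| = 3 -> L \notin indep N' -> circuit N' L.
  move=> sL cL dL; apply/circuitP; rewrite gN sL dL; split=> // x xL.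
  apply: indS; first exact: subset_trans (subsetDl _ _) sL.
  by have := cardsD1 x L; rewrite xL; nat_lia.
exists T, (restriction N' L1), (restriction N' L2), N', p; split.
- by apply: uni => //; apply: subsetUl.
- by apply: uni => //; apply: subsetUr.
- split.
  + by rewrite !gL ?subsetUl ?subsetUr.
  + by rewrite inE sub1set p1 andbT; apply: indS; rewrite ?cards1 // sub1set inE p1 ?orbT.
  + by rewrite inE sub1set p2 andbT; apply: indS; rewrite ?cards1 // sub1set inE p2 ?orbT.
  + by rewrite !gL ?subsetUl ?subsetUr.
  move=> C.
  have s1 := @subsetUl _ L1 L2; have s2 := @subsetUr _ L1 L2.
  have third : (L1 :\ p) :|: (L2 :\ p) = (L1 :|: L2) :\ p by rewrite -setDUl.
  split; last first.
    case=> [/(restrE _ _ s1 c1 d1)->|/(restrE _ _ s2 c2 d2)->|].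
    * exact: kL.
    * exact: kL.
    case=> C1 [C2 [/(restrE _ _ s1 c1 d1)-> /(restrE _ _ s2 c2 d2)-> _ _ ->]].
    rewrite third; apply/circuitP; rewrite gN subsetDl iN ?subsetDl //; split=> //.
      by have := cardsD1 p (L1 :|: L2); rewrite inE p1 cQ; case: leqP => //; nat_lia.
    move=> x xQ; rewrite iN ?(subset_trans (subsetDl _ _)) ?subsetDl //.
    apply/and3P; split.
    * have := cardsD1 p (L1 :|: L2); rewrite inE p1 cQ.
      by have := cardsD1 x ((L1 :|: L2) :\ p); rewrite xQ; nat_lia.
    * by apply/negP => /eqP/setP/(_ p); rewrite !inE p1 eqxx andbF.
    * by apply/negP => /eqP/setP/(_ p); rewrite !inE p2 eqxx andbF.
  move=> cC; have sC : C \subset L1 :|: L2 by rewrite -gN circuit_sub.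
  have [e1|n1] := eqVneq C L1; first by constructor 1; apply/restrE.
  have [e2|n2] := eqVneq C L2; first by constructor 2; apply/restrE.
  have cardC : 3 < #|C|.
    by have := circuit_dep cC; rewrite iN // n1 n2 !andbT -ltnNge.
  (* A circuit other than the lines contains neither of them. If it contained [p], it would miss a
     further point of each, and only three of the five points would remain. *)
  have pC : p \notin C.
    apply/negP => pC.
    have /subsetPn[x x1 xC] : ~~ (L1 \subset C).
      by apply: contra n1 => sL1; rewrite (circuit_min cC (kL _ s1 c1 d1)).
    have /subsetPn[y y2 yC] : ~~ (L2 \subset C).
      by apply: contra n2 => sL2; rewrite (circuit_min cC (kL _ s2 c2 d2)).
    have xy : x != y.
      by apply: contraNneq xC => exy; rewrite (inter x x1) // exy.
    have := subset_leq_card (_ : C \subset (L1 :|: L2) :\ x :\ y).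
    have := cardsD1 y ((L1 :|: L2) :\ x); have := cardsD1 x (L1 :|: L2).
    rewrite !inE x1 y2 eq_sym xy orbT cQ => /= h1 h2 h3.
    suff : C \subset (L1 :|: L2) :\ x :\ y by move/h3; nat_lia.
    by rewrite !subsetD1 sC xC yC.
  constructor 3; exists L1, L2; split=> //; try exact/restrE.
  rewrite third; apply/eqP; rewrite eqEcard subsetD1 sC pC /=.
  by have := cardsD1 p (L1 :|: L2); rewrite inE p1 cQ; nat_lia.
apply: same_isomorphic; split=> //=; apply/setP => I; rewrite inE.
have [iI|//] := boolP (I \in indep N').
by have := iI; rewrite iN -?gN ?indep_sub // => /and3P[->].
Qed.

Lemma Y3_minor X p L1 L2 : L1 :|: L2 \subset ground N -> [disjoint X & L1 :|: L2] ->
  #|L1| = 3 -> #|L2| = 3 -> L1 :&: L2 = [set p] ->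
  (forall I, I \subset L1 :|: L2 ->
    (X :|: I \in indep N) = [&& #|I| <= 3, I != L1 & I != L2]) ->
  has_forbidden_minor.
Proof.
move=> sQ dXQ c1 c2 c12 iXQ.
have iX : X \in indep N.
  rewrite -[X]setU0 iXQ ?sub0set // cards0 /=.
  by apply/andP; split; apply/eqP => e; [move: c1|move: c2]; rewrite -e cards0.
have [N' mN' [gN' iN']] := minor_exists iX sQ dXQ.
exists N'; split=> //; left; apply: (is_Y3_lines c1 c2 c12 gN') => I sI.
by rewrite iN' sI iXQ.
Qed.

End Minor.

(** * A chord of a circuit that is parallel to none of its elements *)

Section Forbidden.
Variables (T : finType) (N : matroid T).
Implicit Types (B C D I J X Y Z W : {set T}) (d e f p x y z : T).

(* [D] is a circuit of the contraction [N / X], and [f] lies in its span without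
   being a loop or parallel to an element of [D].  Contracting elements of [D]
   as long as this persists ends in U_{2,4}, or in a 4-element circuit whose
   elements are paired off by 3-element circuits through [f], which is Y_3. *)
Lemma chord_minor X D f : [disjoint X & D] -> f \notin X :|: D -> 2 < #|D| ->
  f |: (X :|: D) \subset ground N ->
  (forall d, d \in D -> X :|: D :\ d \in indep N) ->
  rk N (f |: (X :|: D)) < #|X| + #|D| ->
  (forall d, d \in D -> X :|: [set d; f] \in indep N) ->
  has_forbidden_minor N.
Proof.
have [k] := ubnP #|D|; elim: k X D => // k IH X D lek dXD fXD gt2 sM iD rD fD.
have [fX fND] : f \notin X /\ f \notin D by move: fXD; rewrite inE negb_or => /andP.
have XD x : x \in D -> x \notin X.
  by move=> xD; apply/negP => xX; rewrite (disjointFr dXD xX) in xD.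
have sub J : J \proper D -> X :|: J \in indep N.
  by move=> /properP[sJ [x xD xJ]]; apply: indep_hered (iD x xD); rewrite setUS // subsetD1 sJ.
have sQ : f |: D \subset ground N by apply: subset_trans sM; rewrite setUS // subsetUr.
have dXQ : [disjoint X & f |: D].
  rewrite disjoint_sym disjoints_subset subUset sub1set inE fX.
  by rewrite -disjoints_subset disjoint_sym.
have cXJ J : J \subset f |: D -> #|X :|: J| = #|X| + #|J|.
  move=> sJ; rewrite cardsU disjoint_setI0 ?cards0 ?subn0 //.
  exact: disjointWr sJ dXQ.
have rXJ J : J \subset f |: D -> rk N (X :|: J) < #|X| + #|D|.
  move=> sJ; apply: leq_ltn_trans (rkS N _) rD; rewrite subUset; apply/andP; split.
    by apply/subsetP => x xX; rewrite !inE xX orbT.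
  apply: subset_trans sJ _; rewrite setUS //; exact: subsetUr.
(* An element [d] can be contracted when three elements remain and [f] becomes parallel to none of
   them. *)
have [d /andP[dD /andP[gt3 /forall_inP hd]]|none] :=
    pickP [pred d | (d \in D) && ((3 < #|D|) &&
      [forall (d' | d' \in D :\ d), X :|: [set d; d'; f] \in indep N])].
  have sM' : (d |: X) :|: D :\ d = X :|: D.
    by apply/setP => x; rewrite !inE; case: eqP => [->|]; rewrite ?dD ?orbT.
  have cd := cardsD1 d D; rewrite dD in cd.
  have cdX : #|d |: X| = (#|X|).+1 by rewrite cardsU1 XD.
  apply: (IH (d |: X) (D :\ d)); rewrite ?sM' //.
  - by move: lek; rewrite cd.
  - rewrite disjoint_sym disjoints_subset; apply/subsetP => x; rewrite !inE => /andP[xd /XD xX].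
    by rewrite negb_or xd.
  - by move: gt3; rewrite cd.
  - move=> d' /setD1P[d'd d'D]; apply: indep_hered (iD d' d'D); apply/subsetP => x.
    rewrite !inE; case: eqP => [->|_] /=; last by case: (x \in X) => //= /and3P[-> _ ->].
    by rewrite eq_sym d'd dD orbT.
  - by rewrite cdX addSnnS; move: rD; rewrite cd add1n.
  move=> d' d'D; have -> : d |: X :|: [set d'; f] = X :|: [set d; d'; f]; last exact: hd.
  by apply/setP => x; rewrite !inE; case: (x \in X); rewrite ?orbT // orbF orbA.
(* With three elements in [D], the four points of [f |: D] have rank two over [X] and any two of
   them are independent: U_{2,4}. *)
have [le3|gt3] := leqP #|D| 3.
  have c3 : #|D| = 3 by nat_lia.
  apply: (U24_minor sQ dXQ); first by rewrite cardsU1 fND c3.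
  move=> I sI; apply/idP/idP => [iI|c2].
    by have := rXJ I sI; rewrite (rk_indep iI) cXJ //; nat_lia.
  have [fI|fI] := boolP (f \in I).
    have cI := cardsD1 f I; rewrite fI in cI.
    have sI' : I :\ f \subset D by rewrite subDset.
    have [d dI dD] : exists2 d, I :\ f \subset [set d] & d \in D.
      have [I0|[d dI]] := set_0Vmem (I :\ f).
        have /card_gt0P[d dD] : 0 < #|D| by rewrite c3.
        by exists d; rewrite // I0 sub0set.
      exists d; last exact: (subsetP sI').
      suff -> : [set d] = I :\ f by [].
      by apply/eqP; rewrite eqEcard sub1set dI cards1; nat_lia.
    apply: indep_hered (fD d dD); apply/setUS/subsetP => x xI.
    have [->|xf] := eqVneq x f; first by rewrite !inE eqxx orbT.
    by have := subsetP dI x; rewrite !inE xf xI => /(_ isT)->.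
  have sI' : I \subset D.
    apply/subsetP => x xI; have := subsetP sI x xI; rewrite !inE => /predU1P[xf|//].
    by rewrite -xf xI in fI.
  by apply: sub; rewrite properEcard sI'; nat_lia.
(* No element can be contracted, so each [d] has a partner [d'] that lies on a line with [d] and [f]
   over [X]. *)
pose par d d' := [&& d \in D, d' \in D, d != d' & X :|: [set d; d'; f] \notin indep N].
have parC d d' : par d d' -> par d' d.
  by case/and4P=> dD d'D ne dep; apply/and4P; split; rewrite // 1?eq_sym // [[set d'; d]]setUC.
have partner d : d \in D -> exists d', par d d'.
  move=> dD; have := none d; rewrite /= dD gt3 /= => /negbT; rewrite negb_forall_in.
  by case/exists_inP=> d' /setD1P[ne d'D] dep; exists d'; apply/and4P; split; rewrite // eq_sym.
have par_sub d d' : par d d' -> [set d; d'; f] \subset f |: D.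
  case/and4P=> dD d'D _ _; apply/subsetP => x; rewrite !inE.
  by case/orP=> [/orP[]|] /eqP->; rewrite ?eqxx ?dD ?d'D ?orbT.
have nf d : d \in D -> d != f by move=> dD; apply: contraNneq fND => <-.
have par_c d d' : par d d' -> #|[set d; d'; f]| = 3.
  by case/and4P=> dD d'D ne _; rewrite setUC cardsU1 cards2 !inE ![f == _]eq_sym !(negbTE (nf _ _)) // ne.
have par_rk d d' : par d d' -> rk N (X :|: [set d; d'; f]) <= #|X| + 2.
  move=> pd; have [dD d'D ne dep] := and4P pd.
  by have := dep_rk dep; rewrite cXJ ?par_sub // par_c //; nat_lia.
have rf d : d \in D -> rk N (X :|: [set d; f]) = #|X| + 2.
  move=> dD; rewrite (rk_indep (fD d dD)) cXJ ?cards2 ?nf //.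
  by apply/subsetP => x; rewrite !inE => /orP[]/eqP->; rewrite ?eqxx ?dD ?orbT.
have D_gt0 : 0 < #|D| by nat_lia.
have rX1 : rk N (X :|: [set f]) = #|X| + 1.
  have /card_gt0P[d dD] := D_gt0.
  rewrite rk_indep ?cXJ ?cards1 ?sub1set ?setU11 //.
  by apply: indep_hered (fD d dD); rewrite setUS // sub1set !inE eqxx orbT.
(* Two lines sharing [d] and [f] span only rank two over [X], whereas [d], [d1], [d2] are three of
   more than three elements of [D] and hence independent over [X]. *)
have par_uniq d d1 d2 : par d d1 -> par d d2 -> d1 = d2.
  move=> p1 p2; apply: contraTeq isT => ne.
  have [dD d1D ne1 _] := and4P p1; have [_ d2D ne2 _] := and4P p2.
  have c3 : #|[set d; d1; d2]| = 3.
    by rewrite setUC cardsU1 cards2 !inE ne1 ![d2 == _]eq_sym (negbTE ne) (negbTE ne2).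
  have s3 : [set d; d1; d2] \subset D.
    by apply/subsetP => x; rewrite !inE => /orP[/orP[]|]/eqP->.
  have i3 : X :|: [set d; d1; d2] \in indep N by apply: sub; rewrite properEcard s3 c3.
  have sdf d' : X :|: [set d; f] \subset X :|: [set d; d'; f].
    by apply/setUS/subsetP => x; rewrite !inE => /orP[]->; rewrite ?orbT.
  have := rk_submodS N (sdf d1) (sdf d2).
  have : rk N (X :|: [set d; d1; d2]) <= rk N (X :|: [set d; d1; f] :|: (X :|: [set d; d2; f])).
    apply: rkS; apply/subsetP => x; rewrite !inE.
    by case/orP=> [->//|/orP[/orP[]|]->]; rewrite ?orbT.
  have := par_rk _ _ p1; have := par_rk _ _ p2.
  rewrite (rf d dD) (rk_indep i3) cXJ ?c3; last exact: subset_trans s3 (subsetUr _ _).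
  by move=> *; exfalso; nat_lia.
have /card_gt0P[d1 d1D] := D_gt0.
have [d2 p12] := partner d1 d1D; have [_ d2D ne12 _] := and4P p12.
have /subsetPn[d3 d3D] : ~~ (D \subset [set d1; d2]).
  by apply: contraL gt3 => /subset_leq_card; rewrite cards2 ne12; nat_lia.
rewrite !inE negb_or => /andP[ne31 ne32].
have [d4 p34] := partner d3 d3D; have [_ d4D ne34 _] := and4P p34.
have ne41 : d4 != d1.
  by apply: contraNneq ne32 => e; rewrite e in p34; rewrite (par_uniq _ _ _ p12 (parC _ _ p34)).
have ne42 : d4 != d2.
  by apply: contraNneq ne31 => e; rewrite e in p34; rewrite (par_uniq _ _ _ (parC _ _ p12) (parC _ _ p34)).
pose L1 := [set d1; d2; f]; pose L2 := [set d3; d4; f].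
have s1 : L1 \subset f |: D := par_sub _ _ p12.
have s2 : L2 \subset f |: D := par_sub _ _ p34.
have c1 : #|L1| = 3 := par_c _ _ p12.
have c2 : #|L2| = 3 := par_c _ _ p34.
have c12 : L1 :&: L2 = [set f].
  apply/setP => x; rewrite !inE; case: (eqVneq x f) => [->|_]; rewrite ?orbT //= !orbF.
  case: (eqVneq x d1) => [->|_] /=; first by rewrite ![d1 == _]eq_sym (negbTE ne31) (negbTE ne41).
  case: (eqVneq x d2) => [->|_] //=; by rewrite ![d2 == _]eq_sym (negbTE ne32) (negbTE ne42).
have fL1 : f \in L1 by rewrite !inE eqxx orbT.
have fL2 : f \in L2 by rewrite !inE eqxx orbT.
have cQ : #|L1 :|: L2| = 5 by have := cardsUI L1 L2; rewrite c12 cards1 c1 c2; nat_lia.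
have cQf : #|(L1 :|: L2) :\ f| = 4.
  by have := cardsD1 f (L1 :|: L2); rewrite inE fL1 cQ; nat_lia.
have rQ : rk N (X :|: (L1 :|: L2)) <= #|X| + 3.
  have sf (L : {set T}) : f \in L -> X :|: [set f] \subset X :|: L by move=> fL; rewrite setUS // sub1set.
  have := rk_submodS N (sf _ fL1) (sf _ fL2).
  rewrite -setUUr; have := par_rk _ _ p12; have := par_rk _ _ p34.
  by rewrite -/L1 -/L2 rX1; nat_lia.
(* The two lines through [f] have rank at most three over [X], so their four points other than [f]
   are dependent over [X] and cannot form a proper subset of [D]. *)
have DE : f |: D = L1 :|: L2.
  have sub1 : L1 :|: L2 \subset f |: D by rewrite subUset s1.
  apply/eqP; rewrite eq_sym eqEcard sub1 cardsU1 fND cQ leqNgt; apply/negP => gt5.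
  have i4 : X :|: (L1 :|: L2) :\ f \in indep N.
    by apply: sub; rewrite properEcard subDset sub1 cQf.
  have := rkS N (setUS X (subsetDl (L1 :|: L2) [set f])).
  rewrite (rk_indep i4) cXJ ?(subset_trans (subsetDl _ _)) // cQf.
  by nat_lia.
have cD : #|D| = 4 by have := cardsU1 f D; rewrite fND DE cQ; nat_lia.
apply: (@Y3_minor _ N X f L1 L2); rewrite -?DE // => I sI; apply/idP/and3P => [iI|[cI n1 n2]].
  split.
  - by have := rXJ I sI; rewrite (rk_indep iI) cXJ //; nat_lia.
  - by apply: contraTneq iI => ->; case/and4P: p12.
  - by apply: contraTneq iI => ->; case/and4P: p34.
have [fI|fI] := boolP (f \in I); last first.
  have sI' : I \subset D.
    apply/subsetP => x xI; have := subsetP sI x xI; rewrite !inE => /predU1P[xf|//].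
    by rewrite -xf xI in fI.
  by apply: sub; rewrite properEcard sI' cD; nat_lia.
have sI' : I :\ f \subset D by rewrite subDset.
have [I0|[d dI]] := set_0Vmem (I :\ f).
  apply: indep_hered (fD d1 d1D); apply/setUS/subsetP => x xI.
  have [->|xf] := eqVneq x f; first by rewrite !inE eqxx orbT.
  by have /setP/(_ x) := I0; rewrite !inE xf xI.
have dD := subsetP sI' d dI.
have [I0|[d' d'I]] := set_0Vmem (I :\ f :\ d).
  apply: indep_hered (fD d dD); apply/setUS/subsetP => x xI.
  have [->|xf] := eqVneq x f; first by rewrite !inE eqxx orbT.
  by have /setP/(_ x) := I0; rewrite !inE xf xI !andbT => /negbFE ->.
have [d'd d'I'] := setD1P d'I.
have d'D := subsetP sI' d' d'I'.
have IE : I = [set d; d'; f].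
  apply/esym/eqP; rewrite eqEcard; apply/andP; split; last first.
    rewrite setUC cardsU1 cards2 !inE ![f == _]eq_sym !(negbTE (nf _ _)) //.
    by rewrite eq_sym d'd.
  apply/subsetP => x; rewrite !inE => /orP[/orP[]|]/eqP-> //.
    by case/setD1P: dI.
  by case/setD1P: d'I'.
(* A dependent triple through [f] makes [d] and [d'] partners, and uniqueness of partners identifies
   the triple with [L1] or [L2]. *)
rewrite IE; apply: contraT => dep; have pdd : par d d'.
  by apply/and4P; split; rewrite // eq_sym.
have : d \in L1 :|: L2 by rewrite -DE inE dD orbT.
rewrite !inE (negbTE (nf d dD)) !orbF => /orP[]/orP[]/eqP ed; rewrite ed in pdd.
- by case/negP: n1; rewrite IE ed (par_uniq _ _ _ pdd p12).
- by case/negP: n1; rewrite IE ed (par_uniq _ _ _ pdd (parC _ _ p12)) [[set d2; d1]]setUC.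
- by case/negP: n2; rewrite IE ed (par_uniq _ _ _ pdd p34).
- by case/negP: n2; rewrite IE ed (par_uniq _ _ _ pdd (parC _ _ p34)) [[set d4; d3]]setUC.
Qed.

End Forbidden.

(** * Components without excluded minors *)

Section Skew.
Variables (T : finType) (N : matroid T).
Implicit Types (B C D I J X Y Z W : {set T}) (d e f p x y z : T).

(** The reverse inequality always holds by submodularity. For disjoint sets, being skew means that
    the restriction of [N] to their union is a direct sum. *)
Definition skew X Y := rk N X + rk N Y <= rk N (X :|: Y).

Lemma skewC X Y : skew X Y = skew Y X.
Proof. by rewrite /skew addnC setUC. Qed.

Lemma skewSl X X' Y : X' \subset X -> skew X Y -> skew X' Y.
Proof.
move=> sX; rewrite /skew => h.
have := rk_submodS N sX (subsetUl X' Y); rewrite setUA (setUidPl sX).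
by nat_lia.
Qed.

Lemma skew_indep X Y I J : skew X Y -> I \subset X -> J \subset Y ->
  I \in indep N -> J \in indep N -> I :|: J \in indep N.
Proof.
move=> sXY sI sJ iI iJ.
have /(skewSl sJ) : skew Y I by rewrite skewC (skewSl sI).
rewrite skewC /skew (rk_indep iI) (rk_indep iJ) indep_rk.
by have := cardsU I J; nat_lia.
Qed.

(** A circuit meeting both sides has proper, hence independent, traces on them, and skewness would
    make their union independent. *)
Lemma skew_circuit X Y C x y : skew X Y -> [disjoint X & Y] -> C \subset X :|: Y ->
  x \in C :&: X -> y \in C :&: Y -> circuit N C -> False.
Proof.
move=> sXY dXY sC /setIP[xC xX] /setIP[yC yY] cC.
have yX : y \notin X by rewrite (disjointFl dXY yY).
have xY : x \notin Y by rewrite (disjointFr dXY xX).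
case/negP: (circuit_dep cC); rewrite -(setIidPl sC) setIUr.
apply: (skew_indep sXY); rewrite ?subsetIr //; apply: circuit_psub cC _.
  by apply/properP; split; [apply: subsetIl|exists y; rewrite // inE negb_and yX orbT].
by apply/properP; split; [apply: subsetIl|exists x; rewrite // inE negb_and xY orbT].
Qed.

Lemma indep_rkD1 Z : (forall z, z \in Z -> rk N (Z :\ z) < rk N Z) -> Z \in indep N.
Proof.
move=> rZ; have [B bB] := basis_of_set_exists N Z.
suff -> : Z = B by apply: basis_indep bB.
apply/eqP; rewrite eqEsubset (basis_sub bB) andbT; apply/subsetP => z zZ.
apply: contraLR (rZ z zZ) => zB; rewrite -leqNgt (rk_basis bB).
by apply: card_le_rk (basis_indep bB) _; rewrite subsetD1 (basis_sub bB).
Qed.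

Lemma circuit_pair C x y : circuit N C -> 2 < #|C| -> x \in C -> y \in C ->
  [set x; y] \in indep N.
Proof.
move=> cC gt2 xC yC; apply: circuit_psub cC _; rewrite properEcard.
rewrite cards2; apply/andP; split; last by case: (x != y); nat_lia.
by apply/subsetP => z; rewrite !inE => /orP[]/eqP->.
Qed.

Lemma spanned_parallel D f : circuit N D -> 2 < #|D| -> f \in ground N -> f \notin D ->
  spans N D f -> ~ has_forbidden_minor N -> exists2 d, d \in D & [set d; f] \notin indep N.
Proof.
move=> cD gt2 fN fD sp noF; apply/exists_inP; apply: contraT.
rewrite negb_exists_in => /forall_inP h; case: noF.
apply: (@chord_minor _ N set0 D f); rewrite ?set0U //.
- by rewrite disjoints_subset sub0set.
- by rewrite subUset sub1set fN circuit_sub.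
- by move=> d dD; rewrite set0U; case/circuitP: cD => _ _; apply.
- by apply: leq_ltn_trans sp _; rewrite cards0 add0n -(rk_circuit cD).
by move=> d dD; rewrite set0U; apply/negPn/h.
Qed.

(* Otherwise a minimal set [Z] outside the span of [D] that is not skew to [D] is
   the rest of an ear of [D].  Contracting all of [Z] but one element gives a
   chord of [D] to which [chord_minor] applies, unless that chord becomes
   parallel to some [d] in [D]; then [Z + d] and [D] are circuits glued at [d],
   and [d] is a chord of the circuit [D - d + Z]. *)
Lemma component_spanned D e f : circuit N D -> 2 < #|D| -> e \in D ->
  f \in component_of N e -> ~ has_forbidden_minor N -> spans N D f.
Proof.
move=> cD gt2 eD fC noF; apply: contra_notT noF => fsp.
set C := component_of N e in fC.
have CN : C \subset ground N by apply/subsetP => x; rewrite inE => /andP[].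
have sDC : D \subset C := circuit_component cD eD.
pose F := [set x in C | spans N D x]; pose W := C :\: F.
have spD d : d \in D -> spans N D d by move=> dD; rewrite /spans (setUidPr _) ?sub1set.
have sDF : D \subset F by apply/subsetP => d dD; rewrite inE (subsetP sDC) ?spD.
have sFC : F \subset C by apply/subsetP => x; rewrite inE => /andP[].
have rF : rk N F = rk N D.
  by rewrite -(@rk_spans _ N D F) ?(setUidPr sDF) // => y; rewrite inE => /andP[].
have WN : W \subset ground N by apply: subset_trans CN; apply: subsetDl.
have fW : f \in W by apply/setDP; split=> //; rewrite inE (negbTE fsp) andbF.
(* Skewness would pass from [D] to its closure [F], which has the same rank, and the circuit through
   [e] and [f] would cross from [F] to [W]. *)
have nskW : ~~ skew D W.
  apply/negP => skDW; have skFW : skew F W.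
    rewrite /skew rF; apply: leq_trans skDW _; exact: rkS (setSU _ sDF).
  have [K cK /andP[eK fK]] : exists2 K, circuit N K & (e \in K) && (f \in K).
    move: fC; rewrite inE => /andP[_ /predU1P[fe|/existsP[K /and3P[cK eK fK]]]].
      by move: fsp; rewrite fe spD.
    by exists K; rewrite ?eK.
  apply: (skew_circuit skFW _ _ (x := e) (y := f) _ _ cK).
  - by rewrite disjoints_subset setCD subsetUr.
  - by rewrite /W -{1}(setIidPr sFC) setID circuit_component.
  - by rewrite inE eK (subsetP sDF).
  - by rewrite inE fK fW.
have [|Z /minsetP[/andP[sZW nskZ] mZ] _] :=
  @minset_exists _ (fun Z => (Z \subset W) && ~~ skew D Z) W; first by rewrite subxx.
have ZN := subset_trans sZW WN.
have skZ z : z \in Z -> skew D (Z :\ z).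
  move=> zZ; apply: contraT => nsk; have /setP/(_ z) : Z :\ z = Z.
    by apply: mZ (subsetDl _ _); rewrite (subset_trans (subsetDl _ _)).
  by rewrite !inE eqxx zZ.
have rZ z : z \in Z -> rk N (Z :\ z) < rk N Z.
  move=> zZ; have := skZ z zZ; move: nskZ; rewrite /skew -ltnNge.
  by have := rkS N (setUS D (subsetDl Z [set z])); nat_lia.
have iZ : Z \in indep N := indep_rkD1 rZ.
have iZ' z : Z :\ z \in indep N by apply: indep_hered (subsetDl _ _) iZ.
have dDZ : [disjoint D & Z].
  rewrite disjoint_sym disjoints_subset; apply/subsetP => z /(subsetP sZW)/setDP[zC].
  by rewrite [z \in ~: _]inE; apply: contra => zD; rewrite inE zC spD.
have ZD z : z \in Z -> z \notin D by move=> zZ; rewrite (disjointFl dDZ zZ).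
have rD := rk_circuit cD.
have [z zZ] : exists z, z \in Z.
  apply/set0Pn; apply: contraNneq nskZ => ->.
  by rewrite /skew rk0 setU0 addn0.
have cZ := cardsD1 z Z; rewrite zZ in cZ.
(* One unit of rank is lost because [D] is a circuit, the other because [Z] is not skew to [D]; no
   more is lost, since [Z :\ z] is skew to [D]. *)
have rDZ : rk N (D :|: Z) + 2 = #|D| + #|Z|.
  have := skZ z zZ; move: nskZ; rewrite /skew -ltnNge (rk_indep iZ) (rk_indep (iZ' z)).
  by have := rkS N (setUS D (subsetDl Z [set z])); nat_lia.
have Z_gt1 : 1 < #|Z|.
  rewrite ltnNge; apply/negP => le1; have := subsetP sZW z zZ.
  have Z1 : Z = [set z] by apply/esym/eqP; rewrite eqEcard sub1set zZ cards1.
  case/setDP=> zC /negP[]; rewrite inE zC /= /spans setUC -Z1.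
  by rewrite Z1 cards1 -Z1 in rDZ; nat_lia.
have iDd d : d \in D -> D :\ d \in indep N by case/circuitP: cD => _ _; apply.
have zX : z |: (Z :\ z :|: D) = D :|: Z by rewrite setUA setD1K // setUC.
have dXD : [disjoint Z :\ z & D].
  by rewrite disjoint_sym; apply: disjointWr dDZ; apply: subsetDl.
have [/forall_inP par|] := boolP [forall (d | d \in D), Z :\ z :|: [set d; z] \in indep N].
  apply: (@chord_minor _ N (Z :\ z) D z); rewrite ?zX //.
  - by rewrite inE setD11 ZD.
  - by rewrite subUset ZN circuit_sub.
  - by move=> d dD; rewrite setUC; apply: (skew_indep (skZ z zZ)); rewrite ?subsetDl ?iDd.
  - by nat_lia.
rewrite negb_forall_in => /exists_inP[d dD depd].
have spZ : spans N Z d.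
  have /dep_rk : d |: Z \notin indep N.
    apply: contra depd; apply: indep_hered; apply/subsetP => x; rewrite !inE.
    by case/orP=> [/andP[_ ->]|/orP[->//|/eqP->]]; rewrite ?zZ ?orbT.
  by rewrite cardsU1 (disjointFr dDZ dD) /spans (rk_indep iZ).
pose D2 := D :\ d :|: Z.
have cDd := cardsD1 d D; rewrite dD in cDd.
have cD2 : #|D2| = #|D :\ d| + #|Z|.
  by rewrite cardsU disjoint_setI0 ?cards0 ?subn0 //; apply: disjointWl dDZ; apply: subsetDl.
have dD2 : d |: D2 = D :|: Z by rewrite setUA setD1K.
apply: (@chord_minor _ N set0 D2 d); rewrite ?set0U ?cards0 ?dD2 //.
- by rewrite disjoints_subset sub0set.
- by rewrite !inE eqxx (disjointFr dDZ dD).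
- by nat_lia.
- by rewrite subUset ZN circuit_sub.
- move=> y yD2; rewrite set0U; have cy := cardsD1 y D2; rewrite yD2 in cy.
  have [yZ|yZ] := boolP (y \in Z).
    have -> : D2 :\ y = D :\ d :|: Z :\ y.
      by apply/setP => x; rewrite !inE; case: eqP => // ->; rewrite (negbTE (ZD y yZ)) andbF.
    by apply: (skew_indep (skZ y yZ)); rewrite ?subsetDl ?iDd.
  have /setD1P[yd yD] : y \in D :\ d by move: yD2; rewrite inE (negbTE yZ) orbF.
  have D2y : d |: D2 :\ y = D :\ y :|: Z.
    apply/setP => x; rewrite !inE; case: (eqVneq x y) => [->|xy]; last by case: eqP => // ->; rewrite dD.
    by rewrite (negbTE yZ) (negbTE yd).
  have sZ : Z \subset D2 :\ y by rewrite subsetD1 subsetUr yZ.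
  (* [Z] restores [d], and [D :\ y] then restores [y]. So [D2 :\ y] has the rank of [D :|: Z], which
     equals its cardinality. *)
  have := spansS sZ spZ; rewrite /spans D2y.
  have /rkS : D :|: Z \subset y |: (D :\ y :|: Z) by rewrite setUA setD1K.
  move=> /(_ N); have := spansS (subsetUl _ Z) (circuit_spans cD yD); rewrite /spans.
  by rewrite indep_rk; nat_lia.
- by nat_lia.
(* The chord [d] is parallel to no [y]: within [D] because [D] has at least three elements, and
   within [Z] because [Z] without some other [y'] is still skew to [D]. *)
move=> y; rewrite set0U inE => /orP[/setD1P[_ yD]|yZ]; first exact: (circuit_pair cD).
have [y' /setD1P[y'y y'Z]] : exists y', y' \in Z :\ y.
  by apply/set0Pn; rewrite -card_gt0; have := cardsD1 y Z; rewrite yZ; nat_lia.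
have : [set d] :|: Z :\ y' \in indep N.
  apply: (skew_indep (skZ y' y'Z)); rewrite ?sub1set ?subxx //.
  by apply: indep_hered (circuit_pair cD gt2 dD dD); rewrite sub1set !inE eqxx.
apply: indep_hered; apply/subsetP => x; rewrite !inE => /orP[]/eqP->; rewrite ?eqxx ?yZ //.
by rewrite (eq_sym y y') y'y orbT.
Qed.

End Skew.

Section Components.
Variables (T : finType) (N : matroid T).
Implicit Types (C D I S Y : {set T}) (e f : T).

Lemma rank_restriction C : rank (restriction N C) = rk N C.
Proof. by apply: eq_bigl => I; rewrite inE. Qed.

Lemma circuit_restriction Y C : circuit N C -> C \subset Y -> circuit (restriction N Y) C.
Proof.
case/circuitP=> sC dC iC sCY; apply/circuitP; split.
- by rewrite subsetI sC.
- by rewrite inE negb_and dC.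
by move=> x xC; rewrite inE iC // (subset_trans (subsetDl _ _)).
Qed.

Lemma restriction_circuit D : circuit N D -> is_circuit_matroid (restriction N D).
Proof.
move=> cD; have cardD := rk_circuit cD; exists #|D|; first by rewrite -cardD.
have gD : ground (restriction N D) = D by apply/setIidPr/circuit_sub.
apply: isomorphic_uniform; rewrite gD // => I sI; rewrite inE sI andbT -cardD /=.
apply/idP/idP => [iI|le]; first exact: card_le_rk.
by apply: circuit_psub cD _; rewrite properEcard sI -cardD.
Qed.

Lemma restriction_parallel Y e f : circuit N [set e; f] -> [set e] \in indep N ->
  e \in Y -> f \notin Y -> parallel_extension (restriction N Y) (restriction N (f |: Y)).
Proof.
move=> cef ie eY fY; have /subsetP sef := circuit_sub cef.
have sI I : (I \subset f |: Y) && (I \subset (ground N :&: (f |: Y)) :\ f) = (I \subset ground N :&: Y).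
  rewrite subsetD1 !subsetI; apply/idP/idP.
    case/andP=> _ /andP[/andP[sIN sI] fI]; rewrite sIN; apply/subsetP => x xI.
    by have := subsetP sI x xI; rewrite !inE => /predU1P[xf|//]; rewrite -xf xI in fI.
  case/andP=> sIN sIY; rewrite sIN (subset_trans sIY (subsetUr _ _)) /=.
  by apply: contra fY; apply: subsetP.
exists e, f; split.
- by rewrite inE sef ?eY // !inE eqxx.
- by rewrite inE (negbTE fY) andbF.
- by rewrite inE ie sub1set.
- by apply: circuit_restriction; rewrite // subUset !sub1set !inE eY eqxx orbT.
split.
  apply/setP => x; rewrite /= !inE; case: eqP => [->|_] /=; first by rewrite (negbTE fY) !andbF.
  by case: (x \in ground N); case: (x \in Y).
apply/setP => I; rewrite /= !inE -andbA sI.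
have [iI|//] := boolP (I \in indep N).
by rewrite subsetI indep_sub.
Qed.

(** By induction on the number of elements outside [D]: removing one of them undoes a parallel
    extension, as its parallel element lies in [D] and remains. *)
Lemma restriction_cpe D Y : circuit N D -> D \subset Y ->
  (forall f, f \in Y :\: D -> exists e, [/\ e \in D, [set e] \in indep N & circuit N [set e; f]]) ->
  circuit_parallel_extension (restriction N Y).
Proof.
move=> cD; have [k] := ubnP #|Y :\: D|; elim: k Y => // k IH Y leY sDY par.
have [Y0|[f fYD]] := set_0Vmem (Y :\: D).
  have -> : Y = D by apply/eqP; rewrite eqEsubset sDY andbT -setD_eq0 Y0.
  by apply/CPE_circuit/restriction_circuit.
have [fY fD] := setDP fYD.
have [e [eD ie cef]] := par f fYD; rewrite -(setD1K fY).
have sub1 : D \subset Y :\ f by rewrite subsetD1 sDY.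
apply: CPE_extend (restriction_parallel cef ie (subsetP sub1 e eD) _); last by rewrite setD11.
apply: IH => //.
  by move: leY; rewrite (cardsD1 f) fYD setDDl setUC -setDDl.
by move=> g /setDP[/setD1P[_ gY] gD]; apply: par; rewrite inE gD.
Qed.

Lemma component_structure C : ~ has_forbidden_minor N -> component N C ->
  rank (restriction N C) <= 1 \/ circuit_parallel_extension (restriction N C).
Proof.
move=> noF [e eN ->]; rewrite -/(component_of N e); set C' := component_of N e.
have mem f : f \in C' -> f != e -> exists2 K, circuit N K & (e \in K) && (f \in K).
  rewrite inE => /andP[_ /predU1P[->|/existsP[K /and3P[cK eK fK]]]]; first by rewrite eqxx.
  by exists K; rewrite ?eK.
have [/existsP[D /and3P[cD eD gt2]]|none] := boolP [exists D : {set T}, [&& circuit N D, e \in D & 2 < #|D|]].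
  right; apply: (restriction_cpe cD); first exact: circuit_component.
  move=> f /setDP[fC fD]; have fe : f != e by apply: contraNneq fD => ->.
  have [K cK /andP[eK fK]] := mem f fC fe.
  have fN := subsetP (circuit_sub cK) f fK.
  have sp := component_spanned cD gt2 eD fC noF.
  have [d dD dep] := spanned_parallel cD gt2 fN fD sp noF.
  have iD : [set d] \in indep N by have := circuit_pair cD gt2 dD dD; rewrite setUid.
  have iF : [set f] \in indep N.
    apply: circuit_psub cK _; apply/properP; rewrite sub1set fK; split=> //.
    by exists e; rewrite // inE eq_sym.
  exists d; split=> //; apply/circuitP; split=> //.
    by rewrite subUset !sub1set fN (subsetP (circuit_sub cD)).
  move=> x; rewrite !inE => /orP[]/eqP->.
    by apply: indep_hered iF; rewrite subDset.
  by apply: indep_hered iD; rewrite subDset setUC.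
(* Circuits through [e] now have at most two elements, so [e] alone spans its component. *)
left; rewrite rank_restriction; apply: leq_trans (rkS N (subsetUr [set e] C')) _.
rewrite rk_spans; first by rewrite (leq_trans (rk_le_card _ _)) ?cards1.
move=> f fC; have [->|fe] := eqVneq f e; first by rewrite /spans setUid.
have [K cK /andP[eK fK]] := mem f fC fe.
apply: spansS (circuit_spans cK fK); have cardK : #|K| <= 2.
  by move: none; rewrite negb_exists => /forallP/(_ K); rewrite cK eK -leqNgt.
rewrite subDset setUC -subDset; suff -> : K = [set e; f] by rewrite subDset setUC subxx.
by apply/esym/eqP; rewrite eqEcard subUset !sub1set eK fK cards2 eq_sym fe.
Qed.

End Components.

(** * Binary laminar matroids *)

Section LinearIndependence.
Local Open Scope ring_scope.

(** As [s] has no repetitions, coefficients can be attached to elements instead of positions. *)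
Lemma free_mapP (K : fieldType) (V : vectType K) (J : eqType) (f : J -> V) (s : seq J) :
  uniq s ->
  free [seq f j | j <- s] <->
  forall a : J -> K, \sum_(j <- s) a j *: f j = 0 -> {in s, forall j, a j = 0}.
Proof.
move=> us; pose t := in_tuple s.
have nthE (i : 'I_(size s)) : (map_tuple f t)`_i = f (tnth t i) by rewrite -tnth_nth tnth_map.
split=> [/(@freeP _ _ _ (map_tuple f t)) fr a a0 j js|indep].
  have ij : (index j s < size s)%N by rewrite index_mem.
  have : a (tnth t (Ordinal ij)) = 0.
    apply: (fr (fun i => a (tnth t i))); rewrite -[RHS]a0 [RHS]big_tnth.
    by apply: eq_bigr => i _; rewrite nthE.
  by rewrite (tnth_nth j) nth_index.
apply/(@freeP _ _ _ (map_tuple f t)) => k k0 i.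
pose a j := if insub (index j s) is Some i then k i else 0.
have aE i' : a (tnth t i') = k i'.
  by rewrite /a (tnth_nth (tnth t i')) index_uniq // valK.
rewrite -aE; apply: indep; last exact: mem_tnth.
rewrite -[RHS]k0 [LHS]big_tnth; apply: eq_bigr => i' _.
by rewrite nthE -aE.
Qed.

Lemma vector_indepP (K : fieldType) m n (A : 'M[K]_(m, n)) (X : {set 'I_n}) :
  X \in indep (vector_matroid A) <->
  forall a : 'I_n -> K, \sum_(j in X) a j *: col j A = 0 -> {in X, forall j, a j = 0}.
Proof.
rewrite inE free_mapP ?enum_uniq //; split=> h a; have := h a.
  by rewrite big_enum => h' /h' a0 j jX; apply: a0; rewrite mem_enum.
by rewrite big_enum => h' /h' a0 j; rewrite mem_enum; apply: a0.
Qed.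

Lemma F2_cases (x : 'F_2) : x = 0 \/ x = 1.
Proof.
by case: x => -[|[|//]] lt; [left|right]; apply: val_inj.
Qed.

(** Over F_2 a linear combination is the sum over its support, so subsets replace coefficient
    functions. *)
Lemma vector_indep_F2 m n (A : 'M['F_2]_(m, n)) (X : {set 'I_n}) :
  X \in indep (vector_matroid A) <->
  forall Z : {set 'I_n}, Z \subset X -> \sum_(j in Z) col j A = 0 -> Z = set0.
Proof.
rewrite vector_indepP; split=> [h Z sZ Z0|h a a0 j jX].
  apply/setP => j; rewrite inE; apply/negP => jZ.
  have : \sum_(j in X) (j \in Z)%:R *: col j A = 0.
    rewrite -[RHS]Z0 [LHS](bigID (mem Z)) /= [X in _ + X]big1 ?addr0; last first.
      by move=> i /andP[_ /negbTE ->]; rewrite scale0r.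
    apply: eq_big => [i|i /andP[_ ->]]; last by rewrite scale1r.
    by rewrite andbC; case: (boolP (i \in Z)) => // /(subsetP sZ).
  by move=> /h/(_ j (subsetP sZ j jZ))/eqP; rewrite jZ oner_eq0.
have Z0 : [set i in X | a i != 0] = set0.
  apply: h; first by apply/subsetP => i; rewrite inE => /andP[].
  rewrite -[RHS]a0 [RHS](bigID (fun i => a i == 0)) /= [X in _ = X + _]big1 ?add0r; last first.
    by move=> i /andP[_ /eqP ->]; rewrite scale0r.
  apply: eq_big => [i|i]; rewrite inE // => /andP[_ ai].
  by case: (F2_cases (a i)) ai => ->; rewrite ?eqxx ?scale1r.
by apply/eqP; apply: contraT => aj; have /setP/(_ j) := Z0; rewrite !inE jX aj.
Qed.

Lemma binary_zero_sum (T : finType) (N : matroid T) x0 : x0 \in ground N -> is_binary N ->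
  exists m (v : T -> 'cV['F_2]_m), forall I : {set T}, I \subset ground N ->
    I \in indep N <-> forall Z : {set T}, Z \subset I -> \sum_(z in Z) v z = 0 -> Z = set0.
Proof.
move=> x0N [m [n [A /(isomorphic_elim x0N)[h [hinj him hI]]]]].
exists m, (fun x => col (h x) A) => I sI; rewrite hI // vector_indep_F2.
have sumE (Z : {set T}) : Z \subset I -> \sum_(j in h @: Z) col j A = \sum_(z in Z) col (h z) A.
  move=> sZ; apply: big_imset => x y xZ yZ; apply: hinj; exact: (subsetP (subset_trans sZ sI)).
split=> H Z sZ Z0.
  apply/eqP; rewrite -(imset_eq0 h); apply/eqP/H; first exact: imsetS.
  by rewrite sumE.
have ZE : Z = h @: (I :&: h @^-1: Z).
  apply/setP => y; apply/idP/imsetP => [yZ|[x]]; last by rewrite !inE => /andP[_ ?] ->.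
  by have /imsetP[x xI yx] := subsetP sZ y yZ; exists x; rewrite // !inE xI -yx.
have /H : I :&: h @^-1: Z \subset I by apply: subsetIl.
by rewrite -sumE ?subsetIl // -ZE => /(_ Z0) Z1; rewrite ZE Z1 imset0.
Qed.

End LinearIndependence.

(** The laminar family is pulled back along the isomorphism. Keeping sets and capacities in a
    relation [P] avoids choosing a capacity for each pulled back set. *)
Lemma laminar_capacities (T : finType) (N : matroid T) x0 : x0 \in ground N -> is_laminar N ->
  exists P : {set T} -> nat -> Prop,
    (forall A c A' c' x, P A c -> P A' c' -> x \in A -> x \in A' -> A \subset A' \/ A' \subset A) /\
    (forall I : {set T}, I \subset ground N ->
       I \in indep N <-> forall A c, P A c -> #|I :&: A| <= c).
Proof.
move=> x0N [S [E [F [c [[sF lF] /(isomorphic_elim x0N)[h [hinj him hI]]]]]]].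
have himE : h @: ground N = E by [].
exists (fun A k => exists B, [/\ B \in F, A = ground N :&: h @^-1: B & k = c B]); split.
  move=> _ _ _ _ x [B [BF -> _]] [B' [B'F -> _]]; rewrite !inE => /andP[_ xB] /andP[_ xB'].
  have [|sub|sub] := lF _ _ BF B'F; first by apply/set0Pn; exists (h x); rewrite inE xB.
    by left; apply/setIS/preimsetS.
  by right; apply/setIS/preimsetS.
move=> I sI; rewrite hI // inE -himE imsetS //=.
have cE B : #|h @: I :&: B| = #|I :&: (ground N :&: h @^-1: B)|.
  have -> : h @: I :&: B = h @: (I :&: (ground N :&: h @^-1: B)).
    apply/setP => y; rewrite inE; apply/andP/imsetP => [[/imsetP[x xI ->] hx]|[x]].
      by exists x; rewrite // !inE xI hx (subsetP sI).
    by rewrite !inE => /and3P[xI _ hx] ->; rewrite imset_f.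
  rewrite card_in_imset // => x y /setIP[/(subsetP sI) xN _] /setIP[/(subsetP sI) yN _].
  exact: hinj.
split=> [/forall_inP H A k [B [BF -> ->]]|H]; first by rewrite -cE H.
by apply/forall_inP => B BF; rewrite cE; apply: H; exists B.
Qed.

(** * Neither excluded minor occurs in a binary laminar matroid *)

Section Exclusion.
Variables (T : finType) (N : matroid T).
Implicit Types (A B I L Q Z : {set T}).

(* The two circuits inside [B + abc] and [B + abd] sum over F_2 to a dependent
   subset of [B + cd]. *)
Lemma binary_no_U24 (N' : matroid T) : is_binary N -> is_minor N' N ->
  ~ isomorphic N' (uniform 2 4).
Proof.
move=> bN /minor_lift[B [sN' dB iN']] iso.
have [|h [hinj him hI]] := isomorphic_elim _ (isomorphic_sym iso) (x0 := ord0) => //.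
have {}hinj : injective h by move=> i j; apply: hinj; rewrite inE.
have hN i : h i \in ground N' by rewrite -him imset_f ?inE.
have [m [v vI]] := binary_zero_sum (subsetP sN' _ (hN ord0)) bN.
have sBN : B \subset ground N.
  have : set0 \in indep N' := indep0 N'.
  by rewrite iN' ?sub0set // setU0; apply: indep_sub.
have sub (I : {set 'I_4}) : B :|: h @: I \subset ground N.
  by rewrite subUset sBN; apply/subsetP => _ /imsetP[i _ ->]; apply: (subsetP sN').
have ind (I : {set 'I_4}) : (B :|: h @: I \in indep N) = (#|I| <= 2).
  have sI : h @: I \subset ground N' by apply/subsetP => _ /imsetP[i _ ->].
  by rewrite -iN' // -hI ?subsetT // inE.
have hB i : h i \notin B by rewrite (disjointFl dB).
(* Leaving out any one point of [I] gives an independent set, so a nonempty zero-sum set must use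
   all three. *)
have zero (I : {set 'I_4}) : #|I| = 3 -> exists Z, [/\ Z \subset B :|: h @: I,
    (\sum_(z in Z) v z)%R = 0%R & {in I, forall i, h i \in Z}].
  move=> c3; have dep : B :|: h @: I \notin indep N by rewrite ind c3.
  have /existsP[Z /and3P[sZ /eqP Z0 nZ]] : [exists Z : {set T},
      [&& Z \subset B :|: h @: I, (\sum_(z in Z) v z)%R == 0%R & Z != set0]].
    apply: contraNT dep; rewrite negb_exists => /forallP noZ; apply/(vI _ (sub I)) => Z sZ Z0.
    by apply/eqP; have := noZ Z; rewrite sZ Z0 eqxx negbK.
  exists Z; split=> // i iI; apply: contraNT nZ => iZ; apply/eqP.
  have /(vI _ (sub _)) : B :|: h @: (I :\ i) \in indep N.
    by rewrite ind; have := cardsD1 i I; rewrite iI c3; nat_lia.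
  apply=> //; apply/subsetP => x xZ; have := subsetP sZ x xZ; rewrite !inE.
  case/orP=> [->//|/imsetP[j jI xj]]; apply/orP; right; rewrite xj imset_f // !inE jI andbT.
  by apply: contraNneq iZ => <-; rewrite -xj.
pose i0 : 'I_4 := inord 0; pose i1 : 'I_4 := inord 1; pose i2 : 'I_4 := inord 2; pose i3 : 'I_4 := inord 3.
pose I1 := [set~ i3]; pose I2 := [set~ i2].
have [|Z1 [s1 z1 in1]] := zero I1; first by rewrite cardsC1 card_ord.
have [|Z2 [s2 z2 in2]] := zero I2; first by rewrite cardsC1 card_ord.
have ne23 : i2 != i3 by rewrite -val_eqE /= !inordK.
(* In the symmetric difference the points of [i0] and [i1] cancel, and that of [i2], present only in
   [Z1], survives. *)
pose D := (Z1 :\: Z2) :|: (Z2 :\: Z1).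
have D0 : (\sum_(z in D) v z)%R = 0%R.
  rewrite (big_setID Z1) /=.
  have -> : D :&: Z1 = Z1 :\: Z2 by apply/setP => x; rewrite !inE; do 2!case: (x \in _).
  have -> : D :\: Z1 = Z2 :\: Z1 by apply/setP => x; rewrite !inE; do 2!case: (x \in _).
  have := z2; have := z1; rewrite (big_setID Z2) [in X in _ -> X](big_setID Z1) setIC /=.
  move=> /(canRL (addKr _)) -> /(canRL (addKr _)) ->.
  rewrite !addr0 -opprD -mulr2n -scaler_nat.
  by rewrite (_ : 2%:R = 0)%R ?scale0r ?oppr0 //; apply: val_inj.
have /(vI _ (sub _))/(_ D) : B :|: h @: [set i2; i3] \in indep N by rewrite ind cards2; case: (_ == _).
have sD : D \subset B :|: h @: [set i2; i3].
  apply/subsetP => x; rewrite !inE => xD; case: (boolP (x \in B)) => //= xB.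
  have [i xi] : exists i, x = h i.
    case/orP: xD => /andP[_]; [move/(subsetP s1)|move/(subsetP s2)].
      by rewrite inE (negbTE xB) => /imsetP[i]; exists i.
    by rewrite inE (negbTE xB) => /imsetP[i]; exists i.
  rewrite xi imset_f // !inE; apply: contraLR xD; rewrite negb_or => /andP[n2 n3].
  by rewrite xi in1 ?in2 ?inE.
move=> /(_ sD D0)/setP/(_ (h i2)); rewrite !inE in1 ?inE //=.
have -> // : h i2 \notin Z2.
  apply/negP => /(subsetP s2); rewrite inE (negbTE (hB _)) => /imsetP[j] jI /hinj ij.
  by rewrite -ij !inE eqxx in jI.
Qed.

(* If the flat of the laminar family violated by [B + L1] lies in the one
   violated by [B + L2], the latter still is when [p] is replaced by a point of
   [L1] off [L2]. *)
Lemma laminar_no_lines B p L1 L2 x0 : x0 \in ground N -> is_laminar N ->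
  p \in L1 -> p \in L2 -> B :|: (L1 :|: L2) \subset ground N ->
  B :|: L1 \notin indep N -> B :|: L2 \notin indep N ->
  (forall x, x \in L1 -> B :|: L1 :\ x \in indep N) ->
  (forall x, x \in L2 -> B :|: L2 :\ x \in indep N) ->
  (forall x, x \in L1 :\ p -> x |: (B :|: L2 :\ p) \in indep N) ->
  (forall x, x \in L2 :\ p -> x |: (B :|: L1 :\ p) \in indep N) ->
  [disjoint B & L1 :|: L2] -> 1 < #|L1| -> 1 < #|L2| -> L1 :&: L2 = [set p] -> False.
Proof.
move=> x0N lN; have [P [lamP indP]] := laminar_capacities x0N lN.
(* Removing any point of [L] repairs the violation, so the violated set contains every point of
   [L]. *)
have violated (L : {set T}) : B :|: L \subset ground N -> B :|: L \notin indep N ->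
    (forall x, x \in L -> B :|: L :\ x \in indep N) ->
    exists A c, [/\ P A c, L \subset A & c < #|(B :|: L) :&: A|].
  move=> sL dL iL.
  have [A [c [PA gt]]] : exists A c, P A c /\ ~~ (#|(B :|: L) :&: A| <= c).
    apply: boolp.contrapT => h; case/negP: dL; apply/(indP _ sL) => A c PA.
    by apply: contraT => gt; case: h; exists A, c.
  exists A, c; rewrite ltnNge; split=> //; apply/subsetP => x xL.
  apply: contraNT gt => xA; have sLx : B :|: L :\ x \subset ground N.
    by apply: subset_trans sL; rewrite setUS ?subsetDl.
  have := (indP _ sLx).1 (iL x xL) A c PA; apply: leq_trans; apply: subset_leq_card.
  apply/subsetP => y /setIP[/setUP[yB|yL] yA]; rewrite !inE ?yB ?yA ?yL //.
  by rewrite andbT orbC; apply/orP; left; rewrite andbT; apply: contraNneq xA => <-.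
have swap (L L' A : {set T}) c : P A c -> p \in L -> p \in L' -> L :&: L' = [set p] ->
    1 < #|L'| -> L :|: L' \subset A -> c < #|(B :|: L) :&: A| -> p \notin B -> [disjoint B & L'] ->
    (forall x, x \in L' :\ p -> x |: (B :|: L :\ p) \in indep N) -> False.
  move=> PA pL pL' LL' gt1 sA gtc pB dB ind.
  have [x xL'] : exists x, x \in L' :\ p.
    by apply/set0Pn; rewrite -card_gt0; have := cardsD1 p L'; rewrite pL'; nat_lia.
  have [xp xL2] := setD1P xL'.
  have iX := ind x xL'; have := (indP _ (indep_sub iX)).1 iX A c PA.
  have -> : (x |: (B :|: L :\ p)) :&: A = x |: (((B :|: L) :&: A) :\ p).
    have xA : x \in A by rewrite (subsetP sA) // inE xL2 orbT.
    apply/setP => y; rewrite !inE; case: (eqVneq y x) => [->|_] /=; first exact: xA.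
    case: (eqVneq y p) => [->|_] //=; first by rewrite (negbTE pB).
  have pA : p \in A by rewrite (subsetP sA) // inE pL.
  have := cardsD1 p ((B :|: L) :&: A); rewrite !inE pL orbT pA /=.
  rewrite cardsU1 !inE xp (disjointFl dB xL2) /=.
  have -> : x \in L = false.
    by apply: contraNF xp => xL; rewrite -in_set1 -LL' inE xL.
  by nat_lia.
move=> p1 p2 sBL d1 d2 i1 i2 s21 s12 dB c1 c2 c12.
have sBL1 : B :|: L1 \subset ground N by apply: subset_trans sBL; rewrite setUS ?subsetUl.
have sBL2 : B :|: L2 \subset ground N by apply: subset_trans sBL; rewrite setUS ?subsetUr.
have dB1 : [disjoint B & L1] by apply: disjointWr dB; apply: subsetUl.
have dB2 : [disjoint B & L2] by apply: disjointWr dB; apply: subsetUr.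
have pB : p \notin B by rewrite (disjointFl dB1 p1).
have [A1 [k1 [PA1 sA1 g1]]] := violated _ sBL1 d1 i1.
have [A2 [k2 [PA2 sA2 g2]]] := violated _ sBL2 d2 i2.
have [sA|sA] := lamP _ _ _ _ p PA1 PA2 (subsetP sA1 p p1) (subsetP sA2 p p2).
  apply: (swap L2 L1 A2 k2) => //; first by rewrite setIC.
  by rewrite subUset sA2 (subset_trans sA1).
apply: (swap L1 L2 A1 k1) => //.
by rewrite subUset sA1 (subset_trans sA2).
Qed.

Lemma uniform23_circuit (S : finType) (M : matroid S) : isomorphic M (uniform 2 3) ->
  #|ground M| = 3 /\ forall C, circuit M C <-> C = ground M.
Proof.
move=> iso; have [|h [hinj him hI]] := isomorphic_elim _ (isomorphic_sym iso) (x0 := ord0) => //.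
have c3 : #|ground M| = 3 by rewrite -him card_in_imset // cardsT card_ord.
have iM (I : {set S}) : I \subset ground M -> (I \in indep M) = (#|I| <= 2).
  move=> sI; have IE : I = h @: (h @^-1: I).
    apply/setP => y; apply/idP/imsetP => [yI|[x]]; last by rewrite inE => ? ->.
    by have := subsetP sI y yI; rewrite -him => /imsetP[x _ yx]; exists x; rewrite // inE -yx.
  by rewrite IE -hI ?subsetT // inE card_in_imset // => x y _ _; apply: hinj; rewrite inE.
split=> // C; split=> [cC|->].
  have sC := circuit_sub cC; have := circuit_dep cC; rewrite iM // -ltnNge => gt2.
  by apply/eqP; rewrite eqEcard sC c3.
apply/circuitP; rewrite iM // c3; split=> // x xM.
by rewrite iM ?subsetDl //; have := cardsD1 x (ground M); rewrite xM c3; nat_lia.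
Qed.

(** Truncation leaves sets of at most three elements. The circuits of the parallel connection that
    fit into them are the two lines, since the third kind has four elements. *)
Lemma Y3_lines (N' : matroid T) : is_Y3 N' -> exists p L1 L2,
  [/\ #|L1| = 3, #|L2| = 3, L1 :&: L2 = [set p], ground N' = L1 :|: L2 &
  forall I, I \subset L1 :|: L2 ->
    (I \in indep N') = [&& #|I| <= 3, I != L1 & I != L2]].
Proof.
case=> S [M1 [M2 [P [p [/uniform23_circuit[c1 C1] /uniform23_circuit[c2 C2] pc iso]]]]].
have [g12 _ _ gP cP] := pc.
have p12 : p \in ground M1 :&: ground M2 by rewrite g12 set11.
have [p1 p2] := setIP p12.
have sP : p \in ground (truncation 3 P) by rewrite /= gP inE p1.
have [h [hinj him hI]] := isomorphic_elim sP (isomorphic_sym iso).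
rewrite /= gP in hinj him hI.
set G1 := ground M1 in c1 C1 g12 gP p1 p12 hinj him hI *.
set G2 := ground M2 in c2 C2 g12 gP p2 p12 hinj him hI *.
have s1 : G1 \subset G1 :|: G2 := subsetUl _ _.
have s2 : G2 \subset G1 :|: G2 := subsetUr _ _.
have cQ : #|G1 :|: G2| = 5 by have := cardsUI G1 G2; rewrite g12 cards1 c1 c2; nat_lia.
have cim (I : {set S}) : I \subset G1 :|: G2 -> #|h @: I| = #|I|.
  by move=> sI; apply: card_in_imset => x y xI yI; apply: hinj; apply: (subsetP sI).
have injI (I J : {set S}) : I \subset G1 :|: G2 -> J \subset G1 :|: G2 -> h @: I = h @: J -> I = J.
  move=> sI sJ e; apply/setP => x; apply/idP/idP => [xI|xJ].
    have : h x \in h @: J by rewrite -e imset_f.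
    by case/imsetP=> y yJ exy; rewrite (hinj _ _ (subsetP sI x xI) (subsetP sJ y yJ) exy).
  have : h x \in h @: I by rewrite e imset_f.
  by case/imsetP=> y yI exy; rewrite (hinj _ _ (subsetP sJ x xJ) (subsetP sI y yI) exy).
exists (h p), (h @: G1), (h @: G2); split.
- by rewrite cim.
- by rewrite cim.
- rewrite -imset_set1 -g12; apply/setP => y; apply/setIP/imsetP => [[/imsetP[x x1 ->] /imsetP[x' x2]]|[x /setIP[x1 x2] ->]].
    move=> e; exists x => //; rewrite inE x1 /=; suff -> : x = x' by [].
    by apply: hinj => //; [apply: (subsetP s1)|apply: (subsetP s2)].
  by rewrite !imset_f.
- by rewrite -him imsetU.
move=> J; rewrite -imsetU => sJ.
have [I sI ->] : exists2 I : {set S}, I \subset G1 :|: G2 & J = h @: I.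
  exists ((G1 :|: G2) :&: h @^-1: J); first exact: subsetIl.
  apply/setP => y; apply/idP/imsetP => [yJ|[x]]; last by rewrite !inE => /andP[_ ?] ->.
  by have /imsetP[x xQ yx] := subsetP sJ y yJ; exists x; rewrite // inE xQ inE -yx.
rewrite -hI // cim // inE andbC; have [le3|//] := leqP #|I| 3; rewrite /=.
have -> : (h @: I != h @: G1) = (I != G1) by congr (~~ _); apply/eqP/eqP => [/injI->|->].
have -> : (h @: I != h @: G2) = (I != G2) by congr (~~ _); apply/eqP/eqP => [/injI->|->].
have k1 : circuit P G1 by apply/cP; constructor 1; apply/C1.
have k2 : circuit P G2 by apply/cP; constructor 2; apply/C2.
apply/idP/andP => [iI|[n1 n2]].
  by split; apply: contraTneq iI => ->; apply: circuit_dep.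
apply: contraT => dI; rewrite -gP in sI.
have [C cC sC] := dep_circuit sI dI.
have big (G : {set S}) : #|G| = 3 -> G \subset I -> I = G.
  by move=> cG sG; apply/esym/eqP; rewrite eqEcard sG cG.
case/cP: cC => [/C1 CE|/C2 CE|[D1 [D2 [/C1 E1 /C2 E2 _ _ CE]]]].
- by case/eqP: n1; apply: big; rewrite // -CE.
- by case/eqP: n2; apply: big; rewrite // -CE.
have := subset_leq_card sC; rewrite CE E1 E2 -setDUl.
by have := cardsD1 p (G1 :|: G2); rewrite inE p1 cQ; nat_lia.
Qed.

Lemma laminar_no_Y3 (N' : matroid T) : is_laminar N -> is_minor N' N -> ~ is_Y3 N'.
Proof.
move=> lN /minor_lift[B [sN' dB iN']] /Y3_lines[p [L1 [L2 [c1 c2 c12 gN' indN']]]].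
rewrite gN' in sN' dB iN'.
have s1 : L1 \subset L1 :|: L2 := subsetUl _ _.
have s2 : L2 \subset L1 :|: L2 := subsetUr _ _.
have p12 : p \in L1 :&: L2 by rewrite c12 set11.
have [p1 p2] := setIP p12.
have small I L : #|L| = 3 -> #|I| < 3 -> I != L by move=> cL; apply: contraTneq => ->; rewrite cL.
have indB I : I \subset L1 :|: L2 -> (B :|: I \in indep N) = [&& #|I| <= 3, I != L1 & I != L2].
  by move=> sI; rewrite -iN' // indN'.
have sBN : B \subset ground N.
  by apply: indep_sub; rewrite -[B]setU0 indB ?sub0set // cards0 !small ?cards0.
have cD1 L x : x \in L -> #|L| = 3 -> #|L :\ x| = 2.
  by move=> xL; rewrite (cardsD1 x) xL; nat_lia.
have indD1 L x : L \subset L1 :|: L2 -> #|L| = 3 -> x \in L -> B :|: L :\ x \in indep N.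
  move=> sL cL xL; rewrite indB ?(subset_trans (subsetDl _ _)) //.
  by rewrite !small ?(cD1 L).
have indU1 L L' x : L \subset L1 :|: L2 -> L' \subset L1 :|: L2 -> L :&: L' = [set p] ->
    #|L| = 3 -> #|L'| = 3 -> (L' = L1 /\ L = L2) \/ (L' = L2 /\ L = L1) -> x \in L :\ p ->
    x |: (B :|: L' :\ p) \in indep N.
  move=> sL sL' LL' cL cL' which /setD1P[xp xL].
  have pL' : p \in L' by have /setP/(_ p) := LL'; rewrite !inE eqxx => /andP[].
  have xL' : x \notin L' by apply: contra xp => xL'; rewrite -in_set1 -LL' inE xL.
  have cX : #|x |: L' :\ p| = 3 by rewrite cardsU1 !inE (negbTE xL') andbF cD1.
  rewrite setUCA indB; last first.
    by rewrite subUset sub1set (subsetP sL) // (subset_trans (subsetDl _ _)).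
  rewrite cX /=; have nL' : x |: L' :\ p != L'.
    by apply: contraNneq xL' => <-; rewrite setU11.
  have nL : x |: L' :\ p != L.
    have pL : p \in L by have /setP/(_ p) := LL'; rewrite !inE eqxx => /andP[].
    by apply: contraTneq pL => <-; rewrite !inE eqxx orbF eq_sym.
  by case: which => -[<- <-]; rewrite nL nL'.
apply: (@laminar_no_lines B p L1 L2 p) => //.
- by apply: (subsetP sN'); apply: (subsetP s1).
- by rewrite subUset sBN.
- by rewrite indB // eqxx /= andbF.
- by rewrite indB // eqxx !andbF.
- by move=> x; apply: indD1.
- by move=> x; apply: indD1.
- by move=> x; apply: (indU1 L1 L2) => //; right.
- by move=> x; apply: (indU1 L2 L1) => //; [rewrite setIC|left].
- by rewrite c1.
- by rewrite c2.
Qed.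

End Exclusion.

(** * Graphic, regular and binary matroids *)

Section Regular.
Local Open Scope ring_scope.

(** Columns of full column rank contain an invertible square block of rows. This criterion by
    determinants is what can be carried from one field to another. *)
Lemma vector_indep_minor (K : fieldType) m n (A : 'M[K]_(m, n)) (X : {set 'I_n}) :
  X \in indep (vector_matroid A) <->
  exists2 f : 'I_#|X| -> 'I_m, injective f & \det (mxsub f (@enum_val _ (mem X)) A) != 0.
Proof.
rewrite vector_indepP; pose B := colsub (@enum_val _ (mem X)) A.
have sumE (a : 'I_n -> K) :
    \sum_(j in X) a j *: col j A = B *m \col_i a (enum_val i).
  rewrite big_enum_val; apply/colP => i; rewrite summxE mxE.
  by apply: eq_bigr => j _; rewrite !mxE mulrC.
have minorE k (f : 'I_k -> 'I_m) : mxsub f (@enum_val _ (mem X)) A = rowsub f B.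
  by apply/matrixP => i j; rewrite !mxE.
split=> [h|[f _ det0] a a0 j jX].
  have freeB : row_free B^T.
    apply: inj_row_free => v vB; apply/rowP => i; rewrite [RHS]mxE.
    have iX := enum_valP i; pose a j := v 0 (enum_rank_in iX j).
    have aE i' : a (enum_val i') = v 0 i' by rewrite /a enum_valK_in.
    rewrite -aE; apply: h => //; rewrite sumE; apply: trmx_inj.
    rewrite trmx_mul trmx0 -[RHS]vB; congr (_ *m _).
    by apply/rowP => i'; rewrite !mxE aE.
  have fullB : row_full B by rewrite /row_full -mxrank_tr.
  exists (fullrankfun fullB); first exact: fullrankfun_inj.
  by rewrite minorE -unitfE -unitmxE fullrowsub_unit.
have unitB : rowsub f B \in unitmx by rewrite unitmxE unitfE -minorE.
have : rowsub f B *m \col_i a (enum_val i) = 0.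
  by rewrite mul_rowsub_mx -sumE a0; apply/matrixP => i k; rewrite !mxE.
move/(congr1 (mulmx (invmx (rowsub f B)))); rewrite mulKmx // mulmx0.
move/colP/(_ (enum_rank_in jX j)); rewrite !mxE enum_rankK_in //.
Qed.

(** The 1 by 1 minors allow [A] to be read as an integer matrix [Z]. In characteristic zero the
    minors of [Z] are also 0, 1 or -1, and such a value vanishes in [K] exactly when it vanishes
    modulo 2. *)
Lemma regular_F2 (K : numFieldType) m n (A : 'M[K]_(m, n)) : totally_unimodular A ->
  exists B : 'M['F_2]_(m, n), indep (vector_matroid A) = indep (vector_matroid B).
Proof.
move=> tuA.
pose Z : 'M[int]_(m, n) := \matrix_(i, j) if A i j == 1 then 1 else if A i j == -1 then -1 else 0.
have AZ : A = map_mx intr Z.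
  apply/matrixP => i j; rewrite !mxE.
  have := tuA 1%N (fun=> i) (fun=> j) _ _; rewrite det_mx11 mxE => tu1.
  have inj1 p (x : 'I_p) : injective (fun _ : 'I_1 => x) by move=> u v _; rewrite !ord1.
  have := tu1 (inj1 _ i) (inj1 _ j); rewrite !inE => /or3P[]/eqP ->.
  - by rewrite eq_sym oner_eq0 eq_sym oppr_eq0 oner_eq0.
  - by rewrite eqxx.
  - by case: eqP => [->//|_]; rewrite eqxx rmorphN1.
have detE (X : {set 'I_n}) (f : 'I_#|X| -> 'I_m) : injective f ->
    (\det (mxsub f (@enum_val _ (mem X)) A) != 0)
    = (\det (mxsub f (@enum_val _ (mem X)) (map_mx intr Z : 'M['F_2]_(m, n))) != 0).
  move=> finj; have := tuA _ _ _ finj (@enum_val_inj _ (mem X)).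
  rewrite {1 2}AZ -!map_mxsub !det_map_mx !inE; set d := \det _.
  rewrite -[in X in [|| X, _ | _]](rmorph0 (intr : int -> K)) -[in X in [|| _, X | _]](rmorph1 (intr : int -> K)).
  rewrite -[in X in [|| _, _ | X]](rmorphN1 (intr : int -> K)) !eqr_int.
  by case/or3P=> /eqP ->; rewrite ?rmorph0 ?eqxx // ?rmorphN1 ?rmorph1 ?oppr_eq0 !oner_eq0.
exists (map_mx intr Z); apply/setP => X.
by apply/idP/idP => /vector_indep_minor[f finj det0]; apply/vector_indep_minor;
   exists f => //; rewrite ?detE // -detE.
Qed.

Lemma regular_binary (T : finType) (N : matroid T) : is_regular N -> is_binary N.
Proof.
case=> m [n [A [tuA [f [bf fI]]]]]; have [B eB] := @regular_F2 Rdefinitions.R m n A tuA.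
by exists m, n, B, f; split=> // I; rewrite fI eB.
Qed.

Section Incidence.
Variables (K : fieldType) (V : finType).

Lemma sum_delta (U : {set V}) (x : V) : \sum_(v in U) (v == x)%:R = (x \in U)%:R :> K.
Proof.
have [xU|xU] := boolP (x \in U).
  by rewrite (bigD1 x) //= eqxx big1 ?addr0 // => v /andP[_ /negbTE->].
by rewrite big1 // => v vU; case: eqP => // vx; rewrite -vx vU in xU.
Qed.

Lemma signs_mul (a b : K) :
  a \in [:: 0; 1; -1] -> b \in [:: 0; 1; -1] -> a * b \in [:: 0; 1; -1].
Proof.
rewrite !inE => /or3P[]/eqP-> /or3P[]/eqP->;
  by rewrite ?mul0r ?mulr0 ?mulr1 ?mul1r ?mulN1r ?opprK eqxx ?orbT.
Qed.

(** Rows are vertices selected by [f], columns are edges from [x j] to [y j]. An edge with an end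
    outside the selection gives a column with at most one nonzero entry, along which to expand; if
    there is none, every column sums to zero. *)
Lemma det_incidence k (f x y : 'I_k -> _) : injective f ->
  \det (\matrix_(i, j) ((f i == x j :> V)%:R - (f i == y j)%:R)) \in [:: 0; 1; -1 : K].
Proof.
elim: k f x y => [|k IH] f x y finj; first by rewrite det_mx00 !inE eqxx orbT.
set M := \matrix_(i, j) _.
have [j nj|allj] := pickP [pred j | (x j \notin codom f) || (y j \notin codom f)].
  have [i [s [sE colj]]] : exists i s, (s \in [:: 0; 1; -1 : K]) /\ (forall i', M i' j = s *+ (i' == i)).
    have out z i' : z \notin codom f -> (f i' == z) = false.
      by move=> zf; apply: contraNF zf => /eqP <-; apply: codom_f.
    have [/codomP[i xi]|xo] := boolP (x j \in codom f).
      have yo : y j \notin codom f by move: nj; rewrite /= xi codom_f.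
      exists i, 1; split=> [|i']; first by rewrite !inE eqxx orbT.
      by rewrite mxE (out _ _ yo) xi (inj_eq finj) subr0.
    have [/codomP[i yi]|yo] := boolP (y j \in codom f).
      exists i, (-1); split=> [|i']; first by rewrite !inE eqxx !orbT.
      by rewrite mxE (out _ _ xo) yi (inj_eq finj) sub0r mulNrn.
    exists ord0, 0; split=> [|i']; first by rewrite !inE eqxx.
    by rewrite mxE !out // subrr mul0rn.
  rewrite (expand_det_col M j) (bigD1 i) //= big1 ?addr0; last first.
    by move=> i' /negbTE ne; rewrite colj ne mulr0n mul0r.
  rewrite colj eqxx mulr1n /cofactor.
  have -> : row' i (col' j M) = \matrix_(i', j') (((f \o lift i) i' == (x \o lift j) j')%:R
      - ((f \o lift i) i' == (y \o lift j) j')%:R).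
    by apply/matrixP => i' j'; rewrite !mxE.
  apply: signs_mul sE (signs_mul _ (IH _ _ _ (inj_comp finj (@lift_inj _ i)))).
  by rewrite -signr_odd !inE; case: (odd _); rewrite ?expr0 ?expr1 eqxx ?orbT.
(* Both ends of every edge are selected, and the all-ones row vector is in the left kernel. *)
suff /eqP -> : \det M == 0 by rewrite !inE eqxx.
apply/det0P; exists (const_mx 1).
  by apply/eqP => /rowP/(_ ord0); rewrite !mxE; apply/eqP; apply: oner_neq0.
apply/rowP => j; rewrite !mxE.
have := allj j; rewrite /= => /negbT; rewrite negb_or !negbK => /andP[/codomP[i xi] /codomP[i' yi]].
have one l : \sum_i0 (f i0 == f l)%:R = 1 :> K.
  rewrite (bigD1 l) //= eqxx big1 ?addr0 // => l' /negbTE ne.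
  by rewrite (inj_eq finj) ne.
transitivity (\sum_i0 ((f i0 == x j)%:R - (f i0 == y j)%:R) : K).
  by apply: eq_bigr => l _; rewrite !mxE mul1r.
by rewrite sumrB xi yi !one subrr.
Qed.

End Incidence.

End Regular.

Section GraphCycles.
Variable G : multigraph.
Implicit Types (e f g : edge G) (x y z : vertex G) (I J C : {set edge G}).

Definition adjacent J x y := [exists e in J, joins e x y].

(** The clause on ends makes the edges distinct: on a simple path no later edge returns to [x]. The
    last clause leaves room for a pair [b] that closes the path to a cycle. *)
Lemma adjacent_path_edges J x p : path (adjacent J) x p -> uniq (x :: p) ->
  exists q : seq (vertex G * edge G),
    [/\ unzip1 q = belast x p, uniq (unzip2 q), {subset unzip2 q <= J},
        {in unzip2 q, forall f, ((ends f).1 \in x :: p) && ((ends f).2 \in x :: p)} &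
        forall b, b.1 = last x p -> sorted (@cycle_step G) (rcons q b)].
Proof.
elim: p x => [|y p IH] x /=; first by exists [::].
case/andP=> /exists_inP[f fJ jf] pth /andP[xp up].
have [q [q1 uq qJ endq srt]] := IH y pth up.
have endf : (((ends f).1 == x) && ((ends f).2 == y)) || (((ends f).1 == y) && ((ends f).2 == x)).
  by case/orP: jf => /eqP ->; rewrite !eqxx ?orbT.
exists ((x, f) :: q); split=> /=.
- by rewrite q1.
- rewrite uq andbT; apply: contra xp => /endq.
  by case/orP: endf => /andP[/eqP-> /eqP->] /andP[].
- by move=> g; rewrite inE => /predU1P[->|/qJ].
- move=> g; rewrite inE => /predU1P[->|/endq/andP[h1 h2]].
    by case/orP: endf => /andP[/eqP-> /eqP->]; rewrite !inE !eqxx ?orbT.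
  by rewrite !(inE, in_cons) in h1 h2 *; rewrite h1 h2 !orbT.
move=> b bl; have := srt b bl; case: (q) q1 => [|c q'] /= q1 srtq; rewrite ?srtq andbT /cycle_step /=.
  have -> : b.1 = y by rewrite bl; case: (p) q1.
  exact: jf.
by case: (p) q1 => // z p' [-> _].
Qed.

Lemma connected_cycle J e : e \notin J ->
  connect (adjacent J) (ends e).1 (ends e).2 ->
  exists2 C, graph_cycle C & C \subset e |: J.
Proof.
move=> eJ /connectP[p0 pth0 lst0]; case/shortenP: pth0 lst0 => p pth up _ lst.
have [q [q1 uq qJ _ srt]] := adjacent_path_edges pth up.
pose b := (last (ends e).1 p, e).
have je x : b.1 = x -> joins e x (ends e).1.
  by move=> <-; rewrite /b /= -lst /joins -surjective_pairing eqxx orbT.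
exists [set f in unzip2 (rcons q b)]; last first.
  apply/subsetP => f; rewrite inE /unzip2 map_rcons mem_rcons inE.
  by case/predU1P=> [->|/qJ fJ]; rewrite !inE ?eqxx ?fJ ?orbT.
exists (rcons q b); split=> //.
- by case: (q).
- by rewrite /unzip1 map_rcons -/(unzip1 q) q1 -lastI.
- rewrite /unzip2 map_rcons rcons_uniq uq andbT.
  by apply: contra eJ => /qJ.
have := srt b erefl; case: (q) q1 => [|c q'] q1 /= srtb.
  have be : b.1 = (ends e).1 by rewrite /b; case: (p) q1.
  by rewrite andbT /cycle_step [X in joins _ _ X]be je.
rewrite rcons_path srtb /= last_rcons /cycle_step /=.
have -> : c.1 = (ends e).1 by case: (p) q1 => // z p' [].
exact: je.
Qed.

End GraphCycles.

(** * The signed incidence matrix represents the cycle matroid *)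

Section IncidenceGraph.
Local Open Scope ring_scope.
Variables (K : fieldType) (G : multigraph).
Implicit Types (e f g : edge G) (x y z v : vertex G) (I J C : {set edge G}).

Definition incidence v e : K := (v == (ends e).1)%:R - (v == (ends e).2)%:R.

(** Let [U] be the vertices reached from one end of [e] by other edges with nonzero coefficient.
    Summing the relation over [U] cancels every edge but [e], so the second end of [e] lies in [U]
    too, which closes a cycle inside [I]. *)
Lemma acyclic_independent I : acyclic I ->
  forall a : edge G -> K, (forall v, \sum_(e in I) a e * incidence v e = 0) ->
  {in I, forall e, a e = 0}.
Proof.
move=> acI a a0 e eI; apply/eqP; apply: contraT => ae.
pose J := [set f in I | (a f != 0) && (f != e)].
pose U := [set v | connect (adjacent J) (ends e).1 v].
have xU : (ends e).1 \in U by rewrite inE connect0.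
suff yU : (ends e).2 \in U.
  have [||C cC sC] := @connected_cycle G J e; first by rewrite !inE eqxx !andbF.
    by move: yU; rewrite inE.
  case/negP: (acI C cC); apply: subset_trans sC _.
  by rewrite subUset sub1set eI; apply/subsetP => f; rewrite inE => /andP[].
have closed f : f \in J -> ((ends f).1 \in U) = ((ends f).2 \in U).
  move=> fJ; have adj12 : adjacent J (ends f).1 (ends f).2.
    by apply/exists_inP; exists f; rewrite // /joins -surjective_pairing eqxx.
  have adj21 : adjacent J (ends f).2 (ends f).1.
    by apply/exists_inP; exists f; rewrite // /joins -surjective_pairing eqxx orbT.
  by rewrite !inE; apply/idP/idP => c; apply: connect_trans c (connect1 _).
have : \sum_(v in U) \sum_(f in I) a f * incidence v f = 0 by rewrite big1.
rewrite exchange_big (bigD1 e) //= [X in _ + X]big1 ?addr0; last first.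
  move=> f /andP[fI fe]; rewrite -mulr_sumr sumrB !sum_delta.
  have [->|af] := eqVneq (a f) 0; first by rewrite mul0r.
  by rewrite closed ?subrr ?mulr0 // inE fI af fe.
rewrite -mulr_sumr sumrB !sum_delta xU => /eqP; rewrite mulf_eq0 (negbTE ae) /=.
by case: (_ \in U) => //; rewrite subr0 oner_eq0.
Qed.

Definition orientation (c : vertex G * edge G) : K := if (ends c.2).1 == c.1 then 1 else -1.

Lemma orientation_step c d v : cycle_step c d ->
  orientation c * incidence v c.2 = (v == c.1)%:R - (v == d.1)%:R.
Proof.
rewrite /cycle_step /joins /orientation /incidence => /orP[]/eqP-> /=.
  by rewrite eqxx mul1r.
case: eqP => [->|_]; first by rewrite subrr mulr0.
by rewrite mulN1r opprB.
Qed.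

Lemma orientation_path c s v : path (@cycle_step G) c s ->
  \sum_(d <- belast c s) orientation d * incidence v d.2
  = (v == c.1)%:R - (v == (last c s).1)%:R.
Proof.
elim: s c => [|d s IH] c /=; first by rewrite big_nil subrr.
case/andP=> st pth; rewrite big_cons (orientation_step v st) IH //.
by rewrite addrA subrK.
Qed.

(** Going around a cycle, the incidence columns signed by [orientation] telescope to zero; as each
    edge is used once, its coefficient is 1 or -1. *)
Lemma independent_acyclic I :
  (forall a : edge G -> K, (forall v, \sum_(e in I) a e * incidence v e = 0) ->
    {in I, forall e, a e = 0}) -> acyclic I.
Proof.
move=> ind C [p [p0 _ up cyc ->]]; case: p p0 up cyc => // c s _ up cyc; apply/negP => sI.
have inI d : d \in c :: s -> d.2 \in I.
  by move=> ds; apply: (subsetP sI); rewrite inE; apply: map_f.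
pose a e := \sum_(d <- c :: s | d.2 == e) orientation d.
have : a c.2 = 0.
  apply: ind; last by apply: inI; apply: mem_head.
  move=> v; transitivity (\sum_(d <- c :: s) orientation d * incidence v d.2); last first.
    by have := orientation_path v cyc; rewrite belast_rcons last_rcons subrr.
  rewrite (eq_bigr (fun e => \sum_(d <- c :: s | d.2 == e) orientation d * incidence v d.2)); last first.
    by move=> e _; rewrite mulr_suml; apply: eq_bigr => d /eqP ->.
  rewrite (exchange_big_dep xpredT) //= big_seq [RHS]big_seq; apply: eq_bigr => d ds.
  rewrite (eq_bigl (pred1 d.2)) ?big_pred1_eq // => e /=.
  by rewrite [e == _]eq_sym; case: eqP => [<-|_]; rewrite ?andbT ?andbF ?inI.
move: up => /= /andP[cs _]; rewrite /a big_cons eqxx big1_seq ?addr0; last first.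
  by move=> d /andP[/eqP dc ds]; case/negP: cs; rewrite -dc; apply: map_f.
by rewrite /orientation; case: ifP => _ /eqP; rewrite ?oppr_eq0 oner_eq0.
Qed.

Lemma graphic_representation : exists A : 'M[K]_(#|vertex G|, #|edge G|),
  totally_unimodular A /\ isomorphic (cycle_matroid G) (vector_matroid A).
Proof.
exists (\matrix_(i, j) incidence (enum_val i) (enum_val j)); split.
  move=> k f g finj ginj.
  set M := mxsub f g _; suff -> : M = \matrix_(i, j)
      (((enum_val \o f) i == (ends (enum_val (g j))).1)%:R
       - ((enum_val \o f) i == (ends (enum_val (g j))).2)%:R).
    exact: det_incidence (inj_comp enum_val_inj finj).
  by apply/matrixP => i j; rewrite !mxE.
apply: (@isomorphic_intro _ _ _ _ enum_rank).
- by move=> e f _ _; apply: enum_rank_inj.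
- apply/setP => j; rewrite !inE; apply/imsetP; exists (enum_val j); rewrite ?inE //.
  by rewrite enum_valK.
move=> I _; rewrite inE.
have colE (a : 'I_#|edge G| -> K) v : (\sum_(j in enum_rank @: I) a j *:
    col j (\matrix_(i, j) incidence (enum_val i) (enum_val j)) : 'cV[K]_#|vertex G|) (enum_rank v) 0
    = \sum_(e in I) a (enum_rank e) * incidence v e.
  rewrite summxE big_imset /=; last by move=> e f _ _; apply: enum_rank_inj.
  by apply: eq_bigr => e _; rewrite !mxE !enum_rankK.
apply/boolp.asboolP/idP => [acI|/vector_indepP ind].
  apply/vector_indepP => a a0 _ /imsetP[e eI ->].
  apply: (acyclic_independent acI (a := a \o enum_rank)) => // v.
  by rewrite /= -colE a0 mxE.
apply: independent_acyclic => a a0 e eI; rewrite -[e]enum_rankK.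
apply: (ind (a \o enum_val)); last exact: imset_f.
apply/colP => i; rewrite -[i]enum_valK colE mxE -[RHS](a0 (enum_val i)).
by apply: eq_bigr => f _; rewrite /= enum_rankK.
Qed.

End IncidenceGraph.

Lemma graphic_regular (T : finType) (N : matroid T) : is_graphic N -> is_regular N.
Proof.
case=> G iso; have [A [tuA isoA]] := graphic_representation Rdefinitions.R G.
by exists _, _, A; split=> //; apply: isomorphic_trans iso isoA.
Qed.

(** * Matroids whose components are circuits with parallel classes *)

Section FunctionalGraph.
Variables (V E : finType) (s : V -> V) (c : E -> V).
Implicit Types (e f : E) (v : V) (I : {set E}) (A : {set V}).

Definition functional_graph := Multigraph (fun e => (c e, s (c e))).

(** Two edges with the same [c] form a 2-cycle, or are loops at a fixed point of [s]; a nonempty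
    closed set covered by [c @: I] contains an orbit of [s], which is a cycle. *)
Lemma functional_acyclicP I : injective s ->
  @acyclic functional_graph I <->
  {in I &, injective c} /\
  (forall A, A != set0 -> {in A, forall v, s v \in A} -> ~~ (A \subset c @: I)).
Proof.
move=> sinj; split=> [acI|[cinj noA] C [p [p0 u1 u2 cyc ->]]].
  split=> [e f eI fI cef|A /set0Pn[v vA] closed].
    apply/eqP; apply: contraT => ef.
    pose v := c e; have [sv|sv] := eqVneq (s v) v.
      have := acI [set e]; rewrite sub1set eI; apply=> //.
      exists [:: (v, e)]; split=> //=; last by apply/setP => x; rewrite !inE.
      by rewrite /cycle_step /joins /= sv eqxx.
    have := acI [set e; f]; rewrite subUset !sub1set eI fI; apply=> //.
    exists [:: (v, e); (s v, f)]; split=> //=.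
    - by rewrite inE eq_sym sv.
    - by rewrite inE ef.
    - by rewrite /cycle_step /joins /= -cef !eqxx orbT.
    - by apply/setP => x; rewrite !inE.
  apply/negP => sA; have pick u : u \in A -> exists2 e, e \in I & c e = u.
    by move=> /(subsetP sA)/imsetP[e eI ->]; exists e.
  have [e0 e0I _] := pick v vA.
  pose pe u := odflt e0 [pick e in I | c e == u].
  have peP u : u \in A -> pe u \in I /\ c (pe u) = u.
    move=> /pick[e eI ce]; rewrite /pe; case: pickP => [e' /andP[? /eqP] //|/(_ e)].
    by rewrite eI ce eqxx.
  have orbA u : u \in orbit s v -> u \in A.
    by case/trajectP=> i _ ->; elim: i => //= i IH; apply: closed.
  pose p := [seq (u, pe u) | u <- orbit s v].
  have p2 : unzip2 p = map pe (orbit s v) by rewrite /unzip2 -map_comp.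
  have : @graph_cycle functional_graph [set e in unzip2 p].
    exists p; split=> //.
    - by rewrite -size_eq0 size_map size_orbit -lt0n order_gt0.
    - by rewrite /unzip1 -map_comp map_id orbit_uniq.
    - rewrite p2 map_inj_in_uniq ?orbit_uniq // => u w /orbA uA /orbA wA /(congr1 c).
      by rewrite !(peP _ _).2.
    - apply: (homo_cycle_in (P := mem A)) (cycle_orbit sinj v) => [u w uA wA /eqP <-|].
        by rewrite /cycle_step /joins /= (peP u uA).2 eqxx.
      by apply/allP.
  move/acI/negP; apply; apply/subsetP => e; rewrite inE p2 => /mapP[u /orbA uA ->].
  by case: (peP u uA).
(* A cycle has as many edges as vertices. As [c] is injective on its edges, every vertex is the [c]
   of one of them, and the vertex set is closed under [s]. *)
apply/negP => sI; pose A := [set v in unzip1 p].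
have inI e : e \in unzip2 p -> e \in I by move=> ep; apply: (subsetP sI); rewrite inE.
have endA e : e \in unzip2 p -> c e \in A /\ s (c e) \in A.
  move=> /mapP[a ap ->]; have := next_cycle cyc ap.
  have h1 : a.1 \in A by rewrite inE map_f.
  have h2 : (next p a).1 \in A by rewrite inE map_f // mem_next.
  by rewrite /cycle_step /joins /= => /orP[]/eqP[-> ->].
have cA : c @: [set e in unzip2 p] = A.
  apply/eqP; rewrite eqEcard; apply/andP; split.
    by apply/subsetP => _ /imsetP[e + ->]; rewrite inE => /endA[].
  rewrite card_in_imset; last by move=> e f; rewrite !inE => /inI eI /inI fI; apply: cinj.
  by rewrite !cardsE (card_uniqP u1) (card_uniqP u2) !size_map.
have /negP[] : ~~ (A \subset c @: I); last by rewrite -cA imsetS.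
apply: noA.
- by rewrite /A; case: (p) p0 => // a p' _; apply/set0Pn; exists a.1; rewrite !inE eqxx.
- by move=> v; rewrite -{1}cA => /imsetP[e + ->]; rewrite inE => /endA[].
Qed.

End FunctionalGraph.

Section CyclicStructure.
Variables (T : finType).
Implicit Types (M N : matroid T) (C D I X Y : {set T}) (e f x y : T).

(** The tag of [cl x] names a component and the ordinal a parallel class in it; [n k] is the length
    of the underlying circuit. Classes may be empty, and [n k = 1] makes the component consist of
    loops. *)
Definition cyclic_structure N (K : finType) (n : K -> nat) (cl : T -> {k : K & 'I_(n k)}) :=
  forall I, I \subset ground N -> I \in indep N <->
    {in I &, injective cl} /\ forall k, #|[set x in I | tag (cl x) == k]| < n k.

Section Consequences.
Variables (N : matroid T) (K : finType) (n : K -> nat) (cl : T -> {k : K & 'I_(n k)}).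
Hypothesis str : cyclic_structure N cl.
Implicit Types (k : K) (u : {k : K & 'I_(n k)}).

Definition next_class u : {k : K & 'I_(n k)} := Tagged (fun k => 'I_(n k)) (ordS (tagged u)).

Lemma next_class_inj : injective next_class.
Proof.
move=> [k i] [k' j]; rewrite /next_class /= => e; have ek : k = k' := congr1 tag e.
case: k' / ek j e => j /eqP; rewrite eq_Tagged /= => /eqP/ordS_inj -> //.
Qed.

Lemma iter_next_class m k (i : 'I_(n k)) :
  iter m next_class (Tagged (fun k => 'I_(n k)) i) = Tagged (fun k => 'I_(n k)) (iter m (@ordS _) i).
Proof. by elim: m => //= m ->. Qed.

Lemma val_iter_ordS p m (i : 'I_p) : val (iter m (@ordS p) i) = (i + m) %% p.
Proof.
elim: m => [|m IH] /=; first by rewrite addn0 modn_small.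
by rewrite IH -[(_ %% _).+1]addn1 modnDml addn1 addnS.
Qed.

Lemma ordS_transitive p (i j : 'I_p) : exists m, iter m (@ordS p) i = j.
Proof.
exists (p - i + j); apply: val_inj; rewrite val_iter_ordS addnA subnKC ?(ltnW (ltn_ord i)) //.
by rewrite modnDl modn_small.
Qed.

Definition class_block k : {set {k : K & 'I_(n k)}} := [set u | tag u == k].

Lemma card_class_block k : #|class_block k| = n k.
Proof.
have -> : class_block k = [set Tagged (fun k => 'I_(n k)) i | i : 'I_(n k)].
  apply/setP => -[k' i]; rewrite inE /=; apply/eqP/imsetP => [ek|[j _ /(congr1 tag)] //].
  by case: k / ek; exists i.
rewrite card_imset ?card_ord // => i j /eqP.
by rewrite eq_Tagged => /eqP.
Qed.

(** A nonempty set of classes closed under [next_class] contains a whole block, so containing no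
    cycle means that no class is repeated and no block is filled. *)
Lemma cyclic_graphic : is_graphic N.
Proof.
pose G := functional_graph next_class (fun e : {x | x \in ground N} => cl (val e)).
exists G; apply/isomorphic_sym/(@isomorphic_intro _ _ _ _ (val : edge G -> T)).
- by move=> e f _ _; apply: val_inj.
- apply/setP => x; apply/imsetP/idP => [[e _ ->]|xN]; first exact: valP.
  by exists (exist _ x xN).
move=> I _; set J := _ @: I.
have sJ : J \subset ground N by apply/subsetP => _ /imsetP[e _ ->]; apply: valP.
have clJ : (fun e : {x | x \in ground N} => cl (val e)) @: I = cl @: J by rewrite -imset_comp.
have injE : {in I &, injective (fun e : {x | x \in ground N} => cl (val e))} <-> {in J &, injective cl}.
  split=> h; last by move=> e f eI fI /h/val_inj; apply; apply: imset_f.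
  by move=> _ _ /imsetP[e eI ->] /imsetP[f fI ->] /(h _ _ eI fI) ->.
have n_gt0 k : 0 < n k.
  by have [_ lt] := (str (sub0set _)).1 (indep0 N); exact: leq_ltn_trans (leq0n _) (lt k).
rewrite inE; apply/boolp.asboolP/idP => [/(functional_acyclicP _ _ next_class_inj)|/(str sJ)[inj lt]].
  rewrite injE clJ => -[inj noA]; apply/(str sJ); split=> // k; rewrite ltnNge; apply/negP => ge.
  set Jk := [set x in J | _] in ge.
  have sB : cl @: Jk = class_block k.
    apply/eqP; rewrite eqEcard card_class_block card_in_imset ?ge ?andbT.
      by apply/subsetP => _ /imsetP[x + ->]; rewrite !inE => /andP[].
    by move=> x y /setIdP[xJ _] /setIdP[yJ _]; apply: inj.
  have /negP[] : ~~ (class_block k \subset cl @: J).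
    by apply: noA => [|u]; rewrite ?inE // -card_gt0 card_class_block.
  by rewrite -sB imsetS //; apply/subsetP => x; rewrite inE => /andP[].
apply/(functional_acyclicP _ _ next_class_inj); rewrite injE clJ; split=> // A /set0Pn[[k i] iA] closed.
apply/negP => sA; have := lt k; rewrite ltnNge => /negP; apply.
rewrite -card_class_block; apply: leq_trans (leq_imset_card cl _); apply: subset_leq_card.
apply/subsetP => -[k' j]; rewrite inE /= => /eqP ek; case: k / ek i iA lt => i iA lt.
have jA : Tagged (fun k => 'I_(n k)) j \in A.
  have [m <-] := ordS_transitive i j; rewrite -iter_next_class.
  by elim: m => //= m; apply: closed.
have /imsetP[x xJ e] := subsetP sA _ jA; rewrite [existT _ _ _]e imset_f // inE xJ -e.
by rewrite /= eqxx.
Qed.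

(** Each member of the family has its rank as capacity, so independent sets respect the capacities
    automatically. Conversely, a class has rank at most one and a component rank less than [n k]. *)
Lemma cyclic_laminar : is_laminar N.
Proof.
pose P u := [set x in ground N | cl x == u].
pose Q k := [set x in ground N | tag (cl x) == k].
pose F := [set P u | u : {k : K & 'I_(n k)}] :|: [set Q k | k : K].
have FP A : A \in F -> (exists u, A = P u) \/ exists k, A = Q k.
  by rewrite inE => /orP[]/imsetP[a _ ->]; [left|right]; exists a.
have lamF : laminar_family (ground N) F.
  split=> [A /FP[[u ->]|[k ->]]|A B /FP hA /FP hB /set0Pn[x /setIP[]]].
  - by apply/subsetP => x; rewrite inE => /andP[].
  - by apply/subsetP => x; rewrite inE => /andP[].
  case: hA hB => [[u ->]|[k ->]] [[u' ->]|[k' ->]]; rewrite !inE => /andP[_ /eqP <-] /andP[_ /eqP <-].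
  - by left.
  - by left; apply/subsetP => y; rewrite !inE => /andP[-> /eqP->] /=.
  - by right; apply/subsetP => y; rewrite !inE => /andP[-> /eqP->] /=.
  - by left.
exists T, (ground N), F, (rk N), lamF; apply: same_isomorphic; split=> //.
apply/setP => I; rewrite inE; apply/idP/andP => [iI|[sI /forall_inP H]].
  split; first exact: indep_sub.
  by apply/forall_inP => A _; apply: card_le_rk (subsetIr _ _); apply: indep_hered (subsetIl _ _) iI.
apply/(str sI); split=> [x y xI yI cxy|k].
  apply: contraTeq isT => xy; have := H (P (cl x)); rewrite inE imset_f // => /(_ isT).
  have [B bB] := basis_of_set_exists N (P (cl x)).
  have sB : B \subset ground N by apply: indep_sub (basis_indep bB).
  have B1 : #|B| <= 1.
    apply/card_le1_eqP => a b aB bB'; apply: ((str sB).1 (basis_indep bB)).1 => //.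
    have := subsetP (basis_sub bB) a aB; have := subsetP (basis_sub bB) b bB'.
    by rewrite !inE => /andP[_ /eqP->] /andP[_ /eqP->].
  rewrite (rk_basis bB) leqNgt (leq_ltn_trans B1) //; apply/card_gt1P; exists x, y.
  by rewrite !inE xI yI cxy eqxx !(subsetP sI).
have [B bB] := basis_of_set_exists N (Q k).
have sB : B \subset ground N by apply: indep_sub (basis_indep bB).
have BE : [set x in B | tag (cl x) == k] = B.
  apply/setP => x; rewrite inE; case xB: (x \in B) => //=.
  by have := subsetP (basis_sub bB) x xB; rewrite inE => /andP[_ ->].
have := ((str sB).1 (basis_indep bB)).2 k; rewrite BE -(rk_basis bB); apply: leq_ltn_trans.
apply: leq_trans (H (Q k) _); last by rewrite inE imset_f // orbT.
by apply: subset_leq_card; apply/subsetP => x; rewrite !inE => /andP[xI ->]; rewrite xI (subsetP sI).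
Qed.

End Consequences.

(* Rank-one matroids without loops are included, with [n = 2] and a constant [g]. *)
Definition circuit_like M := exists n (g : T -> 'I_n), 0 < n /\
  forall I, I \subset ground M -> I \in indep M <-> {in I &, injective g} /\ #|I| < n.

Lemma circuit_like_circuit M : is_circuit_matroid M -> circuit_like M.
Proof.
case=> [[//|n] _ iso].
have [|h [_ him _]] := isomorphic_elim _ (isomorphic_sym iso) (x0 := ord0) => //.
have x0M : h ord0 \in ground M by rewrite -him imset_f // inE.
have [g [ginj _ gI]] := isomorphic_elim x0M iso.
exists n.+1, g; split=> // I sI.
have ginI : {in I &, injective g} by move=> x y xI yI; apply: ginj; apply: (subsetP sI).
by rewrite gI // inE card_in_imset //; split=> [lt|[]].
Qed.

Lemma parallel_swap M e f X : circuit M [set e; f] -> e != f -> e \notin X -> f \notin X ->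
  (e |: X \in indep M) = (f |: X \in indep M).
Proof.
have sp x y : circuit M [set x; y] -> x != y -> rk M (x |: (y |: X)) = rk M (y |: X).
  move=> cxy xy; apply/eqP; rewrite eqn_leq; apply/andP; split; last exact: rkS (subsetUr _ _).
  apply: spansS (circuit_spans cxy (set21 x y)); apply/subsetP => z; rewrite !inE.
  by case/andP=> zx; rewrite (negbTE zx) /= => /eqP ->; rewrite eqxx.
move=> cef ef eX fX; rewrite !indep_rk !cardsU1 eX fX -(sp e f) // -(sp f e) //.
  by rewrite setUCA.
  by rewrite setUC.
by rewrite eq_sym.
Qed.

(** The new element [f] receives the class of [e]. A set with [f] but not [e] is compared with [M]
    after exchanging [f] for [e]. *)
Lemma circuit_like_parallel M M' : parallel_extension M M' -> circuit_like M -> circuit_like M'.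
Proof.
case=> e [f [eM fM ie cef [gM iM]]] [n [g [n0 gI]]].
have ef : e != f by apply: contraNneq fM => <-.
have iE I : I \subset ground M' :\ f -> (I \in indep M) = (I \in indep M').
  by move=> sI; rewrite -iM /= inE sI andbT.
have gE : ground M = ground M' :\ f by rewrite -gM /=; apply/setIidPr/subsetDl.
exists n, (fun x => if x == f then g e else g x); split=> // I sI.
have [fI|fI] := boolP (f \in I); last first.
  have sI' : I \subset ground M' :\ f by rewrite subsetD1 sI.
  rewrite -iE // gI ?gE //; have neq x : x \in I -> (x == f) = false.
    by move=> xI; apply: contraNF fI => /eqP <-.
  split=> -[inj lt]; split=> // x y xI yI.
    by rewrite !neq //; apply: inj.
  by have := inj x y xI yI; rewrite !neq.
have [eI|eI] := boolP (e \in I).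
  split=> [iI|[inj _]].
    case/negP: (circuit_dep cef); apply: indep_hered iI.
    by rewrite subUset !sub1set eI.
  by case/eqP: (ef); apply: inj => //; rewrite (negbTE ef) eqxx.
have eIf : e \notin I :\ f by rewrite inE (negbTE eI) andbF.
have -> : (I \in indep M') = (e |: I :\ f \in indep M').
  by rewrite -{1}(setD1K fI) (parallel_swap cef) // ?setD11.
have sJ : e |: I :\ f \subset ground M' :\ f.
  by rewrite -gE subUset sub1set eM gE setSD.
have cJ : #|e |: I :\ f| = #|I| by rewrite cardsU1 eIf (cardsD1 f I) fI.
rewrite -iE // gI ?gE // cJ; split=> -[inj lt]; split=> // x y xI yI.
  pose h z := if z == f then e else z.
  have hJ z : z \in I -> h z \in e |: I :\ f.
    by rewrite /h => zI; case: eqP => [_|/eqP zf]; rewrite !inE ?eqxx // zf zI orbT.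
  have hE z : (if z == f then g e else g z) = g (h z) by rewrite /h; case: ifP.
  rewrite !hE => /(inj _ _ (hJ x xI) (hJ y yI)); rewrite /h.
  case: eqP => [->|_]; case: eqP => [->|_] // exy.
    by rewrite exy yI in eI.
  by rewrite -exy xI in eI.
pose h z := if z == e then f else z.
have hI z : z \in e |: I :\ f -> h z \in I.
  by rewrite /h !inE; case: eqP => //= _ /andP[].
have hE z : z \in e |: I :\ f -> g z = (if h z == f then g e else g (h z)).
  rewrite /h !inE; case: (eqVneq z e) => [->|_] /=; first by rewrite eqxx.
  by case/andP=> /negbTE ->.
rewrite (hE x) // (hE y) // => /(inj _ _ (hI x xI) (hI y yI)); rewrite /h.
move: xI yI; rewrite !inE; case: (eqVneq x e) => [->|_]; case: (eqVneq y e) => [->|_] //=.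
  by move=> _ /andP[/negbTE yf _] fy; rewrite fy eqxx in yf.
by move=> /andP[/negbTE xf _] _ fx; rewrite fx eqxx in xf.
Qed.

Lemma circuit_like_cpe M : circuit_parallel_extension M -> circuit_like M.
Proof.
elim=> [M0|M0 M1 _ IH pe]; first exact: circuit_like_circuit.
exact: circuit_like_parallel pe IH.
Qed.

(** A loop shares no circuit with another element, so the component is either a single loop, with
    [n = 1], or free of loops, with [n = 2]. *)
Lemma circuit_like_rank1 N C : component N C -> rk N C <= 1 -> circuit_like (restriction N C).
Proof.
case=> e eN ->; rewrite -/(component_of N e); set C' := component_of N e => r1.
have iE I : I \subset ground (restriction N C') ->
    (I \in indep (restriction N C')) = (I \in indep N) /\ I \subset C'.
  by rewrite subsetI => /andP[_ sI]; rewrite inE sI andbT.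
have mem f : f \in C' -> f != e -> exists2 K, circuit N K & (e \in K) && (f \in K).
  rewrite inE => /andP[_ /predU1P[->|/existsP[K /and3P[cK eK fK]]]]; first by rewrite eqxx.
  by exists K; rewrite ?eK.
have single K x y : circuit N K -> x \in K -> y \in K -> x != y -> [set x] \in indep N.
  move=> cK xK yK xy; apply: circuit_psub cK _; apply/properP; rewrite sub1set xK; split=> //.
  by exists y; rewrite // inE eq_sym.
have [ie|de] := boolP ([set e] \in indep N).
  exists 2, (fun=> ord0); split=> // I /iE[-> sI]; split=> [iI|[_ lt]].
    have le1 : #|I| <= 1 by apply: leq_trans r1; apply: card_le_rk.
    by split=> // x y xI yI _; move/card_le1_eqP: le1; apply.
  have [->|[x xI]] := set_0Vmem I; first exact: indep0.
  have -> : I = [set x] by apply/esym/eqP; rewrite eqEcard sub1set xI cards1.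
  have xC := subsetP sI x xI; have [->//|xe] := eqVneq x e.
  have [K cK /andP[eK xK]] := mem x xC xe; exact: single cK xK eK xe.
have C1 : C' \subset [set e].
  apply/subsetP => f fC; rewrite inE; apply: contraR de => fe.
  by have [K cK /andP[eK fK]] := mem f fC fe; apply: single cK eK fK _; rewrite eq_sym.
exists 1, (fun=> ord0); split=> // I /iE[-> sI]; split=> [iI|[_]]; last first.
  by rewrite ltnS leqn0 cards_eq0 => /eqP->; apply: indep0.
have I0 : I = set0.
  apply/eqP; apply: contraNT de => /set0Pn[x xI].
  by apply: indep_hered iI; rewrite sub1set; have /set1P <- := subsetP C1 x (subsetP sI x xI).
by rewrite I0 cards0; split=> // x y; rewrite inE.
Qed.

Lemma components_cyclic N : (forall C, component N C -> circuit_like (restriction N C)) ->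
  exists (K : finType) (n : K -> nat) (cl : T -> {k : K & 'I_(n k)}), cyclic_structure N cl.
Proof.
move=> like.
have /boolp.choice[F FP] C : exists F : {n & T -> 'I_n}, 0 < tag F /\ (component N C ->
    forall I, I \subset ground N -> I \subset C ->
    I \in indep N <-> {in I &, injective (tagged F)} /\ #|I| < tag F).
  (* All subsets of [T] serve as indices. One that is not a component contains no element of the
     ground set as a tag and gets length 1, so its bound [0 < 1] is harmless. *)
  have [cC|nC] := boolp.pselect (component N C); last by exists (existT _ 1 (fun=> ord0)); split.
  have [n [g [n0 gI]]] := like C cC; exists (existT _ n g); split=> // _ I sI sIC.
  have sI' : I \subset ground (restriction N C) by rewrite subsetI sI.
  have -> : I \in indep N = (I \in indep (restriction N C)) by rewrite inE sIC andbT.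
  exact: gI.
pose n (C : {set T}) := tag (F C).
pose cl x : {C : {set T} & 'I_(n C)} := Tagged (fun C => 'I_(n C)) (tagged (F (component_of N x)) x).
exists {set T}, n, cl => I sI.
have FC e : e \in ground N -> forall J : {set T}, J \subset I -> J \subset component_of N e ->
    J \in indep N <-> {in J &, injective (tagged (F (component_of N e)))} /\ #|J| < n (component_of N e).
  by move=> eN J sJ; apply: (FP _).2 (component_ofP eN) _ (subset_trans sJ sI).
have clE C x y : component_of N x = C -> component_of N y = C ->
    (cl x == cl y) = (tagged (F C) x == tagged (F C) y).
  by move=> <- eyx; rewrite /cl eyx eq_Tagged.
have compE e x : x \in I -> e \in I -> (component_of N x == component_of N e) = (x \in component_of N e).
  move=> xI eI; apply/eqP/idP => [<-|/component_ofE -> //].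
  by rewrite mem_component ?(subsetP sI).
split=> [iI|[inj lt]].
  split=> [x y xI yI cxy|C].
    have exy : component_of N x = component_of N y := congr1 tag cxy.
    have [inj _] := (FC x (subsetP sI x xI) _ (subsetIl I _) (subsetIr I _)).1 (indep_hered (subsetIl _ _) iI).
    apply: inj; first by rewrite in_setI xI -compE ?eqxx.
      by rewrite in_setI yI -compE // exy eqxx.
    by apply/eqP; move/eqP: cxy; rewrite (clE (component_of N x) x y).
  have [->|[e]] := set_0Vmem [set x in I | tag (cl x) == C].
    by rewrite cards0; case: (FP C).
  rewrite inE => /andP[eI /eqP <-].
  have -> : [set x in I | tag (cl x) == tag (cl e)] = I :&: component_of N e.
    by apply/setP => x; rewrite in_setI [LHS]inE; case xI: (x \in I) => //=; rewrite compE.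
  by have [] := (FC e (subsetP sI e eI) _ (subsetIl I _) (subsetIr I _)).1 (indep_hered (subsetIl _ _) iI).
(* A circuit inside [I] would lie in a single component, where it inherits both conditions from [I]
   and is therefore independent. *)
apply: contraT => dI; have [D cD sD] := dep_circuit sI dI.
have [D0|[e eD]] := set_0Vmem D.
  by have := circuit_dep cD; rewrite D0 indep0.
have eI := subsetP sD e eD; have eN := subsetP sI e eI.
case/negP: (circuit_dep cD); apply/(FC e eN) => //; first exact: circuit_component.
have sDC := circuit_component cD eD.
split=> [x y xD yD /eqP exy|].
  have cE z : z \in D -> component_of N z = component_of N e.
    by move=> zD; rewrite (component_ofE (subsetP sDC z zD)).
  by apply: inj; rewrite ?(subsetP sD) //; apply/eqP; rewrite (@clE (component_of N e)) ?cE.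
apply: leq_ltn_trans (lt (component_of N e)); apply: subset_leq_card.
by apply/subsetP => x xD; rewrite inE (subsetP sD) //= compE ?(subsetP sD) ?(subsetP sDC).
Qed.

End CyclicStructure.

Theorem theorem5p2 (T : finType) (N : matroid T) :
  [<-> (forall C : {set T}, component N C ->
          rank (restriction N C) <= 1 \/
          circuit_parallel_extension (restriction N C));
       is_graphic N /\ is_laminar N;
       is_regular N /\ is_laminar N;
       is_binary N /\ is_laminar N;
       ~ (exists N' : matroid T, is_minor N' N /\
            (is_Y3 N' \/ isomorphic N' (uniform 2 4)))].
Proof.
tfae.
- move=> comps; have [C cC|K [n [cl str]]] := @components_cyclic _ N.
    have [r1|] := comps C cC; last exact: circuit_like_cpe.
    by apply: circuit_like_rank1 => //; rewrite -rank_restriction.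
  by split; [apply: cyclic_graphic str|apply: cyclic_laminar str].
- by case=> gN lN; split=> //; apply: graphic_regular.
- by case=> rN lN; split=> //; apply: regular_binary.
- case=> bN lN [N' [mN' [Y|U]]]; first exact: laminar_no_Y3 lN mN' Y.
  exact: binary_no_U24 bN mN' U.
- by move=> noF C cC; apply: component_structure.
Qed.
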